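(* Let $(X,f)$ be a dynamical system satisfying the non-uniform $\tau$-specification property. If $\tau<\infty$, then for any $m+n$ distinct ergodic measures $\mu_1,\dots,\mu_m,\nu_1,\dots,\nu_n\in\mathcal{M}_f^{erg}(X)$ (with $m,n$ positive integers) and any non-empty open set $U\subset X$, there exists an uncountable DC1-scrambled set contained in $$\Big(\bigcap_{1\leq i\leq m}\bigcap_{1\leq j\leq n}(G^{\mu_i}\setminus G^{\nu_j})\Big)\cap U\cap\mathrm{Trans}(f).$$
   Context: A dynamical system $(X,f)$ consists of a compact metric space $(X,d)$ with at least two points and a continuous map $f:X\to X$. $\mathbb{N}$ denotes the positive integers. $\mathcal{M}_f^{erg}(X)$ is the set of $f$-ergodic ($f$-invariant) Borel probability measures on $X$; measures carry the weak* topology. Non-uniform specification property: $(X,f)$ satisfies the non-uniform specification property with gap function $M(n,\varepsilon):\mathbb{N}\times(0,+\infty)\to\mathbb{N}$ if (i) $M(n,\varepsilon)$ is non-decreasing in $n$ and non-increasing in $\varepsilon$; (ii) for every $\varepsilon>0$, any integer $k\ge2$, any $x_1,\dots,x_k\in X$ and any non-negative integers $a_1\le b_1<a_2\le b_2<\cdots<a_k\le b_k$ with $a_{i+1}-b_i\ge M(b_i-a_i+1,\varepsilon)$ for $1\le i\le k-1$, there exists $z\in X$ such that $d(f^{n-a_i}x_i,f^nz)\le\varepsilon$ for all $a_i\le n\le b_i$ and $1\le i\le k$. Non-uniform $\tau$-specification property ($\tau\in[0,\infty]$): let $\mathscr{G}(X,f)$ be the collection of all gap functions for which $(X,f)$ satisfies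 the non-uniform specification property, and for $M\in\mathscr{G}(X,f)$ let $\tau(M)=\sup_{\varepsilon>0}\liminf_{n\to\infty}\frac{M(n,\varepsilon)}{n}$. $(X,f)$ satisfies the non-uniform $\tau$-specification property if there is $M\in\mathscr{G}(X,f)$ with $\tau(M)=\tau$ and every $M'\in\mathscr{G}(X,f)$ satisfies $\tau(M')\ge\tau$. For $x\in X$ and $n\in\mathbb{N}$ let $\delta_x^n=\frac1n\sum_{k=0}^{n-1}\delta_{f^kx}$, and let $V_f(x)$ be the set of weak* accumulation points of $\{\delta_x^n\}_{n\ge1}$. For an invariant measure $\mu$, $G^{\mu}=\{x\in X:\mu\in V_f(x)\}$. $\mathrm{Trans}(f)=\{x\in X:\omega(x,f)=X\}$, where $\omega(x,f)$ is the $\omega$-limit set of $x$. A pair $\{x,y\}$ is DC1-scrambled if for every $t>0$, $\limsup_{n\to\infty}\frac1n|\{j\in[0,n-1]:d(f^jx,f^jy)<t\}|=1$, and there exists $t_0>0$ such that $\liminf_{n\to\infty}\frac1n|\{j\in[0,n-1]:d(f^jx,f^jy)<t_0\}|=0$ (here $j$ ranges over integers). A set $S\subset X$ is DC1-scrambled if each pair of distinct points of $S$ is DC1-scrambled. *)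

(* Defs.v *)
From HB Require Import structures.
From mathcomp Require Import all_boot all_order all_algebra.
From mathcomp Require Import all_classical all_reals all_analysis.

Set Implicit Arguments.
Unset Strict Implicit.
Unset Printing Implicit Defensive.

Import Order.TTheory GRing.Theory Num.Theory.
Import numFieldNormedType.Exports.

Local Open Scope classical_set_scope.
Local Open Scope ring_scope.

(* [measurableType] inherits from [pointedType], so a metric space must carry a
   point before its Borel sigma-algebra can be formed; the point plays no other
   role. *)
#[short(type="pointedMetricType")]
HB.structure Definition PointedMetric (R : numDomainType) :=
  {T of Pointed T & Metric R T}.

Notation borel X := (g_sigma_algebraType (@open X)).

Section specification.
Context {R : realType} {X : metricType R}.
Implicit Types (f : X -> X) (M : nat -> R -> nat).

(* A gap function is defined on positive integers and positive reals; values of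
   [M] at [n = 0] or [e <= 0] are unconstrained and never used. *)
Definition gap_function M : Prop :=
  [/\ forall n e, (0 < n)%N -> 0 < e -> (0 < M n e)%N,
      forall n n' e, (0 < n)%N -> (n <= n')%N -> 0 < e ->
        (M n e <= M n' e)%N
    & forall n e e', (0 < n)%N -> 0 < e -> e <= e' -> (M n e' <= M n e)%N].

(* The indices 1, ..., k are shifted to 0, ..., k - 1; values of [x], [a] and
   [b] at indices [i >= k] are irrelevant. *)
Definition nonuniform_specification f M : Prop :=
  gap_function M /\
  forall e : R, 0 < e ->
  forall k : nat, (2 <= k)%N ->
  forall (x : nat -> X) (a b : nat -> nat),
    (forall i, (i < k)%N -> (a i <= b i)%N) ->
    (forall i, (i.+1 < k)%N -> (b i < a i.+1)%N) ->
    (forall i, (i.+1 < k)%N -> (M (b i - a i + 1)%N e <= a i.+1 - b i)%N) ->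
  exists z : X, forall i n, (i < k)%N -> (a i <= n <= b i)%N ->
    mdist (iter (n - a i) f (x i)) (iter n f z) <= e.

Definition gap_tau M : \bar R :=
  ereal_sup [set limn_einf (fun n => ((M n e)%:R / n%:R)%:E) | e in
    [set e : R | 0 < e]].

Definition nonuniform_tau_specification f (tau : \bar R) : Prop :=
  (exists2 M, nonuniform_specification f M & gap_tau M = tau) /\
  (forall M, nonuniform_specification f M -> (tau <= gap_tau M)%E).

End specification.

Section orbits.
Context {R : realType} {X : metricType R}.
Implicit Types (f : X -> X) (x y : X) (t : R) (S : set X).

Definition omega_limit f x : set X :=
  cluster ((fun n => iter n f x) @ \oo).

Definition Trans f : set X := [set x | omega_limit f x = [set: X]].

Definition close_freq f x y t (n : nat) : \bar R :=
  (#|[pred j : 'I_n | mdist (iter j f x) (iter j f y) < t]|%:R / n%:R)%:E.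

Definition DC1_pair f x y : Prop :=
  (forall t, 0 < t -> limn_esup (close_freq f x y t) = 1%E) /\
  (exists2 t0, 0 < t0 & limn_einf (close_freq f x y t0) = 0%E).

Definition DC1_scrambled f S : Prop :=
  forall x y, S x -> S y -> x <> y -> DC1_pair f x y.

End orbits.

Section measures.
Context {R : realType} {X : pointedMetricType R}.
Implicit Types (f : X -> X) (x : X) (mu nu : probability (borel X) R).

Definition invariant_measure f mu : Prop :=
  forall A : set (borel X), measurable A -> mu (f @^-1` A) = mu A.

Definition ergodic_measure f mu : Prop :=
  invariant_measure f mu /\
  forall A : set (borel X), measurable A -> f @^-1` A = A ->
    mu A = 0%E \/ mu A = 1%E.

(* Elements of [probability] are functions on all subsets, so two of them are
   the same measure when they agree on measurable sets, which is weaker than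
   Leibniz equality. *)
Definition same_measure mu nu : Prop :=
  forall A : set (borel X), measurable A -> mu A = nu A.

Definition integral_map mu : {ptws continuousType X R -> R} :=
  fun phi => Rintegral mu setT phi.

Definition weak_star : Type := initial_topology integral_map.

HB.instance Definition _ := Topological.on weak_star.

Section empirical.
Variables (f : X -> X) (x : X) (n : nat).

(* This is delta_x^{n+1}: the index is shifted so that n = 0 is meaningful. *)
Definition empirical : set (borel X) -> \bar R :=
  mscale (n.+1%:R^-1)%:nng
    (msum (fun k => @dirac _ (borel X) (iter k f x) R) n.+1).

HB.instance Definition _ := Measure.on empirical.

Let empirical_setT : empirical setT = 1%E.
Proof.
rewrite /empirical /mscale /= /msum (eq_bigr (fun=> 1%E)) => [|k _].
  by rewrite sumEFin sumr_const card_ord -EFinM mulVf.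
exact: diracT.
Qed.

HB.instance Definition _ :=
  Measure_isProbability.Build _ _ _ empirical empirical_setT.

End empirical.

(* Accumulation points of the sequence (not merely of the set of its values). *)
Definition Vf f x : set weak_star :=
  cluster ((fun n => (empirical f x n : probability (borel X) R) : weak_star)
           @ \oo).

Definition Gmu f mu : set X := [set x | Vf f x mu].

End measures.

Arguments weak_star {R} X.

(* Main.v *)
(* Fix an integer T > liminf M(n, e)/n for every e; lengths n with M(n, e) <= T n
   ("good" lengths) are then arbitrarily large.  A point z is built by successive
   shadowing: z_{k+1} follows z_k on [0, l_k), with l_k good, then visits a prescribed
   point, then follows the orbit of a prescribed y_k until a good time l_{k+1} much larger
   than the start of that last block.  Each y_k is either a generic point of some mu_i or
   one of two points w_0, w_1 whose orbits stay a positive distance apart.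

   At times l_{k+1} the empirical measure is close to that of y_k, so every mu_i is an
   accumulation point.  At all times the blocks fill a fraction of the past that is bounded
   below in terms of T only.  To exclude nu_j, use the ergodic theorem to obtain a
   continuous g >= 0 with int g dmu_i >= 1/2 for all i and int g dnu_j as small as we
   like, while the averages of g along z stay above a constant depending on T.  The points
   w_0, w_1 come from specification at a fixed scale: they periodically follow a generic
   point of one mu_i, so that their averages of g are bounded below too, and visit two
   different points.

   Indexing the choices between w_0 and w_1 by sequences of bits, each bit being used
   infinitely often, yields the uncountable DC1-scrambled set: two points are close during
   the blocks following generic points and far apart during the blocks where their bits
   differ. *)
Require Import Defs.
From mathcomp Require Import all_boot all_order all_algebra.
From mathcomp Require Import all_classical all_reals all_analysis.
From mathcomp Require Import finmap measurable_realfun ring lra zify.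

Import Order.TTheory GRing.Theory Num.Theory.
Import numFieldNormedType.Exports.

Local Open Scope classical_set_scope.
Local Open Scope ring_scope.

(** * Compact metric spaces *)

Lemma infinitely_often_enumeration {C : countType} (c0 : C) :
  exists t : nat -> C, forall c N, exists2 k, (N <= k)%N & t k = c.
Proof.
(* The 2-adic valuation takes each value infinitely often. *)
exists (fun k => odflt c0 (choice.unpickle (logn 2 k))) => c N.
exists (2 ^ choice.pickle c * (2 * N).+1)%N.
  by rewrite (leq_trans _ (leq_pmull _ _)) ?expn_gt0//; lia.
rewrite lognM ?expn_gt0// pfactorK// logn_coprime ?addn0 ?choice.pickleK//.
by rewrite coprime2n oddS oddM.
Qed.

Section compact_metric.
Context {R : realType} {X : pointedMetricType R}.
Hypothesis compactX : compact [set: X].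

Lemma continuous_mdistP {Y : pseudoMetricType R} (h : X -> Y) (x : X) (e : R) :
  {for x, continuous h} -> 0 < e ->
  exists2 d, 0 < d & forall y, mdist x y < d -> ball (h x) e (h y).
Proof.
move=> hx e0; have /nbhs_ballP[d /= d0 dh] := hx _ (nbhsx_ballx (h x) e e0).
by exists d => // y xy; apply: dh; rewrite ballEmdist.
Qed.

(** Compactness enters as near-covering: each point has a neighbourhood and a bound on [d] that work
    together. The non-strict [mdist x y <= d] matches the estimates delivered by specification. *)
Lemma uniform_continuity {Y : pseudoMetricType R} (h : X -> Y) (e : R) :
  continuous h -> 0 < e ->
  exists2 d, 0 < d & forall x y, mdist x y <= d -> ball (h x) e (h y).
Proof.
move=> ch e0.
have /compact_near_coveringP/(_ R (0^'+)
  (fun d x => forall y, mdist x y <= d -> ball (h x) e (h y)) _) := compactX.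
case=> [x _|d /= d0 H]; last first.
  exists (d / 2); first by rewrite divr_gt0.
  move=> x y xy; apply: (H (d / 2)) => //=; last by rewrite divr_gt0.
  by rewrite sub0r normrN gtr0_norm ?divr_gt0// ltr_pdivrMr// ltr_pMr// ltr1n.
have [d d0 dh] := @continuous_mdistP _ h x (e / 2) (ch x) (divr_gt0 e0 (ltr0n _ 2)).
exists (ball x (d / 2), [set r | r < d / 2]).
  split; first by apply: nbhsx_ballx; rewrite divr_gt0.
  by apply: nbhs_right_lt; rewrite divr_gt0.
case=> x' r /= [xx' rd] y x'y; rewrite ballEmdist /= in xx'.
apply: (@ball_splitr _ _ (h x)); apply: dh.
  by rewrite (lt_le_trans xx')// ler_pdivrMr// ler_pMr// ler1n.
rewrite (le_lt_trans (metric_triangle _ x' _))// [ltRHS]splitr.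
by rewrite ltrD// (le_lt_trans x'y).
Qed.

Lemma uniform_continuity_iter (f : X -> X) (P : nat) (e : R) :
  continuous f -> 0 < e ->
  exists2 d, 0 < d & forall r x y, (r <= P)%N -> mdist x y <= d ->
    mdist (iter r f x) (iter r f y) < e.
Proof.
move=> cf; elim: P => [|P IH] in e *.
  move=> e0; exists (e / 2); first by rewrite divr_gt0.
  move=> r x y; rewrite leqn0 => /eqP-> /= /le_lt_trans; apply.
  by rewrite ltr_pdivrMr// ltr_pMr// ltr1n.
move=> e0; have [d1 d10 H1] := @uniform_continuity _ f e cf e0.
have d1e : 0 < Num.min e d1 by rewrite lt_min e0.
have [d d0 H] := IH _ d1e; exists d => // r x y.
rewrite leq_eqVlt => /predU1P[->|rP] xy.
  have := H1 (iter P f x) (iter P f y); rewrite ballEmdist /=; apply.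
  by have := H P x y (leqnn _) xy; rewrite lt_min => /andP[_ /ltW].
by have := H r x y rP xy; rewrite lt_min => /andP[].
Qed.

Lemma continuous_bounded (h : X -> R) :
  continuous h -> exists2 B, 0 < B & forall x, `|h x| <= B.
Proof.
move=> ch.
have /compact_near_coveringP/(_ R +oo (fun B x => `|h x| <= B) _) := compactX.
case=> [x _|B [Br H]]; last first.
  exists (Num.max (B + 1) 1) => [|x]; first by rewrite lt_max ltr01 orbT.
  by apply: H => //; rewrite lt_max ltrDl ltr01.
have [d d0 dh] := @continuous_mdistP _ h x 1 (ch x) ltr01.
exists (ball x d, [set r | `|h x| + 1 < r]).
  by split; [exact: nbhsx_ballx|exact: nbhs_pinfty_gt].
case=> y r /= [xy rd]; rewrite ballEmdist /= in xy.
apply: ltW; apply: le_lt_trans rd; have := dh _ xy; rewrite /ball/= => /ltW hxy.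
by have := ler_normD (h x) (h y - h x); rewrite subrKC => /le_trans->//; rewrite lerD2l distrC.
Qed.

Lemma finite_net (e : R) : 0 < e ->
  exists s : seq X, forall x, exists2 y, y \in s & mdist y x < e.
Proof.
move=> e0; have := compactX; rewrite compact_cover.
move=> /(_ X setT (fun x => (ball x e)°)).
case=> [x _|x _|D _ H].
- exact: open_interior.
- by exists x => //; exact: nbhsx_ballx.
- exists (enum_fset D) => x; have [y /= yD /interior_subset] := H x I.
  by rewrite ballEmdist => xy; exists y.
Qed.

(** Any cluster point of [z] will do; all closed conditions hold at this one point, so no
    subsequence has to be extracted. *)
Lemma closed_cluster (z : nat -> X) :
  exists x, forall C : set X, closed C -> (exists K, forall k, (K <= k)%N -> C (z k)) ->
    C x.
Proof.
have [x [_ zx]] := compactX (z @ \oo) _ filterT.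
exists x => C cC [K KC]; apply: cC => B Bx.
apply: zx => //; exists K => // k /=; exact: KC.
Qed.

Lemma continuous_iter (f : X -> X) n : continuous f -> continuous (iter n f).
Proof.
move=> cf; elim: n => [|n IH] x; first exact: cvg_id.
by apply: continuous_comp; [exact: IH|exact: cf].
Qed.

Lemma mdist_lipschitz (a x y : X) : `|mdist a x - mdist a y| <= mdist x y.
Proof.
have := metric_triangle a x y; have := metric_triangle a y x.
by rewrite (metric_sym y x) => h1 h2; apply/ler_normlP; split; lra.
Qed.

Lemma continuous_mdist (a : X) : continuous (mdist a : X -> R).
Proof.
move=> x; apply/cvgrPdist_lt => e e0.
apply/nbhs_ballP; exists e => // y; rewrite ballEmdist /= => xy.
exact: le_lt_trans (mdist_lipschitz _ _ _) xy.
Qed.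

Lemma closed_shadow (f : X -> X) (a : X) n (e : R) : continuous f ->
  closed [set z | mdist a (iter n f z) <= e].
Proof.
move=> cf; apply: (@closed_comp _ _ (fun z => mdist a (iter n f z)) [set r | r <= e]).
  move=> x _; apply: (@continuous_comp _ _ _ (iter n f) (mdist a)).
    exact: continuous_iter.
  exact: continuous_mdist.
exact: closed_le.
Qed.

(** The finite nets of mesh [1/(j+1)] are listed together, each pair of a net and a position in it
    recurring infinitely often. *)
Lemma dense_enumeration : exists p : nat -> X,
  forall x (e : R) N, 0 < e -> exists2 k, (N <= k)%N & mdist (p k) x < e.
Proof.
have [net netP] : exists net : nat -> seq X, forall j x,
    exists2 y, y \in net j & mdist y x < j.+1%:R^-1.
  have [net netP] := choice (fun j : nat => @finite_net j.+1%:R^-1 ltac:(by rewrite invr_gt0)).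
  by exists net.
have [idx idxP] := infinitely_often_enumeration (0%N, 0%N).
exists (fun k => nth point (net (idx k).1) (idx k).2) => x e N e0.
have [y yj xy] := netP (Num.truncn e^-1) x.
have [k Nk idxk] := idxP (Num.truncn e^-1, index y (net (Num.truncn e^-1))) N.
exists k => //; rewrite idxk /= nth_index// (lt_trans xy)//.
by rewrite -[ltRHS]invrK ltf_pV2 ?posrE ?invr_gt0// truncnS_gt.
Qed.

End compact_metric.

(** * Shadowing under the non-uniform specification property *)

Section limits_inferior_superior.
Context {R : realType}.
Implicit Types (u : nat -> \bar R) (l : \bar R).
Local Open Scope ereal_scope.

Lemma limn_einf_ge u l N : (forall n, (N <= n)%N -> l <= u n) -> l <= limn_einf u.
Proof.
move=> Nu; rewrite limn_einf_lim; apply: lime_ge; first exact: is_cvg_einfs.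
exists N => // n /= Nn; apply: le_ereal_inf_tmp => _ [k /= nk <-].
exact: Nu (leq_trans Nn nk).
Qed.

Lemma limn_einf_le u l :
  (forall N, exists2 n, (N <= n)%N & u n <= l) -> limn_einf u <= l.
Proof.
move=> fu; rewrite limn_einf_lim; apply: lime_le; first exact: is_cvg_einfs.
near=> n; have [k nk ukl] := fu n; apply: le_trans ukl.
by apply: ereal_inf_lbound; exists k.
Unshelve. all: by end_near. Qed.

Lemma limn_esup_le u l N : (forall n, (N <= n)%N -> u n <= l) -> limn_esup u <= l.
Proof.
move=> Nu; rewrite -[limn_esup u]oppeK -limn_einfN leeNl.
by apply: (@limn_einf_ge _ _ N) => n /Nu; rewrite leeN2.
Qed.

Lemma limn_esup_ge u l :
  (forall N, exists2 n, (N <= n)%N & l <= u n) -> l <= limn_esup u.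
Proof.
move=> fu; rewrite -[limn_esup u]oppeK -limn_einfN leeNr.
by apply: limn_einf_le => N; have [n Nn un] := fu N; exists n => //; rewrite leeN2.
Qed.

End limits_inferior_superior.

Section specification.
Context {R : realType} {X : pointedMetricType R}.
Variables (f : X -> X) (M : nat -> R -> nat).
Hypotheses (compactX : compact [set: X]) (cont_f : continuous f).
Hypothesis specM : nonuniform_specification f M.

(** [gap_tau] is a supremum over [e], so one integer [T] above it serves all scales. If [M n e]
    exceeded [T * n] for all large [n], the liminf at scale [e] would be at least [T]. *)
Lemma linear_gaps : (gap_tau M < +oo)%E ->
  exists T : nat, forall e : R, 0 < e -> forall N,
    exists2 n, (N <= n)%N & (M n e <= T * n)%N.
Proof.
move=> tauM; have [T tauT] : exists T : nat, (gap_tau M < T%:R%:E)%E.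
  case: (gap_tau M) tauM => [r _| |_] //; last by exists 0%N; rewrite ltNyr.
  exists (Num.truncn `|r|).+1; rewrite lte_fin.
  by rewrite (le_lt_trans (ler_norm r))// truncnS_gt.
exists T => e e0 N; absurd_not => H.
suff : (T%:R%:E <= gap_tau M)%E by rewrite leNgt tauT.
apply: (@le_trans _ _ (limn_einf (fun n => ((M n e)%:R / n%:R)%:E))); last first.
  by apply: ereal_sup_ubound; exists e.
apply: (@limn_einf_ge _ _ _ N.+1) => n Nn; rewrite lee_fin.
rewrite ler_pdivlMr ?ltr0n ?(leq_ltn_trans _ Nn)// -natrM ler_nat ltnW//.
by apply: H; exact: ltnW.
Qed.

(** The first [k + 2] segments are shadowed by some [z k]; the conditions are closed, so a cluster
    point satisfies all of them. *)
Lemma infinite_specification (e : R) (x : nat -> X) (a b : nat -> nat) :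
  0 < e -> (forall i, (a i <= b i)%N) -> (forall i, (b i < a i.+1)%N) ->
  (forall i, (M (b i - a i + 1)%N e <= a i.+1 - b i)%N) ->
  exists z, forall i n, (a i <= n <= b i)%N ->
    mdist (iter (n - a i) f (x i)) (iter n f z) <= e.
Proof.
move=> e0 ab ba gap; have [_ spec] := specM.
have [z zP] := choice (fun k => spec e e0 k.+2 isT x a b
  (fun i _ => ab i) (fun i _ => ba i) (fun i _ => gap i)).
have [w wP] := closed_cluster compactX z.
exists w => i n ain; have := wP _ (closed_shadow f (iter (n - a i) f (x i)) n e cont_f); apply.
by exists i => k ik; apply: (zP k) => //; rewrite ltnS (leq_trans ik).
Qed.

(** Specification for three segments: a piece of [u], one instant at [p], a block of [y]. Both gaps
    are [M L e], enough after the visit since [M 1 e <= M L e]. Gaps are measured from the last time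
    of a segment, [L - 1] for the first, hence the predecessors. *)
Lemma extend_orbit (e : R) (L L' : nat) (u p y : X) :
  0 < e -> (0 < L)%N -> ((L + 2 * M L e).-1 < L')%N ->
  exists z, [/\ forall n, (n < L)%N -> mdist (iter n f u) (iter n f z) <= e,
    mdist p (iter (L + M L e).-1 f z) <= e
  & forall n, ((L + 2 * M L e).-1 <= n < L')%N ->
      mdist (iter (n - (L + 2 * M L e).-1) f y) (iter n f z) <= e].
Proof.
move=> e0 L0 sL'; have [[M0 Mn _] spec] := specM.
have G0 := M0 L e L0 e0; have M1L : (M 1 e <= M L e)%N by exact: Mn.
set G := M L e in G0 sL' M1L *; pose s := (L + 2 * G).-1.
have [|||z zP] := spec e e0 3%N isT (nth u [:: u; p; y])
    (nth 0%N [:: 0; (L + G).-1; s])%N (nth 0%N [:: L.-1; (L + G).-1; L'.-1])%N.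
- by move=> [|[|[|i]]] //= _; rewrite /s; lia.
- by move=> [|[|[|i]]] //= _; rewrite /s; lia.
- move=> [|[|[|i]]] //= _; first by rewrite subn0 addn1 prednK// -/G; lia.
  by rewrite subnn add0n /s; lia.
exists z; split.
- by move=> n nL; have := zP 0%N n isT; rewrite /= subn0; apply; lia.
- by have := zP 1%N (L + G).-1 isT; rewrite /= subnn; apply; lia.
- by move=> n nL; have := zP 2%N n isT; rewrite /=; apply; rewrite /s; lia.
Qed.

End specification.

Section nested_shadowing.
Context {R : realType} {X : pointedMetricType R}.
Variables (f : X -> X) (M : nat -> R -> nat).
Hypotheses (compactX : compact [set: X]) (cont_f : continuous f).
Hypothesis specM : nonuniform_specification f M.

(** The tolerance decreases with [k] so that on late blocks it falls below any modulus of uniform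
    continuity. *)
Definition shadows (e : R) (s l : nat -> nat) (y : nat -> X) (z : X) : Prop :=
  forall k n, (s k <= n < l k.+1)%N ->
    mdist (iter (n - s k) f (y k)) (iter n f z) <= e / 2 ^+ k.

(** [extend_orbit] is iterated from [u] with tolerance [e / 2 ^+ k.+1] at step [k]. All later
    corrections together cost at most as much again, whence the radius [e / 2 ^+ k] in the limit. *)
Lemma nested_shadowing (e : R) (l : nat -> nat) (u : X) (p y : nat -> X) :
  let G k := M (l k) (e / 2 ^+ k.+1) in
  let s k := (l k + 2 * G k).-1 in
  0 < e -> (forall k, 0 < l k)%N -> (forall k, s k < l k.+1)%N ->
  exists z, [/\ mdist u z <= e,
    forall k, mdist (p k) (iter (l k + G k).-1 f z) <= e / 2 ^+ k
  & shadows e s l y z].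
Proof.
move=> G s e0 l0 sl; pose d k := e / 2 ^+ k.
have d0 k : 0 < d k by rewrite divr_gt0// exprn_gt0.
have dS k : d k = d k.+1 + d k.+1.
  by rewrite /d exprS; field; rewrite gt_eqF// exprn_gt0.
have [F FP] := choice (fun kv : nat * X => extend_orbit _ _ specM _ _ _ kv.2
  (p kv.1) (y kv.1) (d0 kv.1.+1) (l0 kv.1) (sl kv.1)).
pose z := fix z k := if k is j.+1 then F (j, z j) else u.
have lS k : (l k <= l k.+1)%N by have := sl k; rewrite /s /G; lia.
have lle : {homo l : k j / (k <= j)%N} := homo_leq leqnn leq_trans lS.
(* The radii [d k] halve, so the successive corrections [d k.+1], ..., [d j]
   telescope. *)
have zz k j n : (k <= j)%N -> (n < l k)%N ->
    mdist (iter n f (z k)) (iter n f (z j)) <= d k - d j.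
  move=> /subnKC <- nl; elim: (j - k)%N => [|i IH].
    by rewrite addn0 mdistxx subrr.
  rewrite addnS; have [H _ _] := FP ((k + i)%N, z (k + i)%N).
  apply: le_trans (metric_triangle _ (iter n f (z (k + i)%N)) _) _.
  have {}H : mdist (iter n f (z (k + i)%N)) (iter n f (z (k + i).+1)) <= d (k + i).+1.
    exact: H n (leq_trans nl (lle _ _ (leq_addr i k))).
  by have := dS (k + i)%N; lra.
have [w wP] := closed_cluster compactX z.
have near_w k n x : (n < l k.+1)%N -> mdist x (iter n f (z k.+1)) <= d k.+1 ->
    mdist x (iter n f w) <= d k.
  move=> nl xz; have := wP _ (closed_shadow f x n (d k) cont_f); apply.
  exists k.+1 => j kj.
  apply: le_trans (metric_triangle _ (iter n f (z k.+1)) _) _.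
  by have := zz _ _ _ kj nl; have := dS k; have := d0 j; lra.
exists w; split.
- have := wP _ (closed_shadow f u 0%N e cont_f); apply.
  exists 0%N => j _ /=; have := zz 0%N j 0%N isT (l0 _); have := d0 j.
  by rewrite /= {2}/d expr0 divr1; lra.
- move=> k; have [_ H _] := FP (k, z k); apply: (near_w) => //.
  by have := sl k; rewrite /s /G /=; lia.
- move=> k n /andP[sn nl]; have [_ _ H] := FP (k, z k); apply: near_w => //.
  by apply: H; rewrite sn.
Qed.

(** The choice is recursive, since the size required of [l k.+1] depends on the gap after [l k]. The
    factor [k.+1] makes the time before block [k] negligible at the end of that block. *)
Lemma block_lengths (e : R) (T : nat) : 0 < e ->
  (forall e' : R, 0 < e' -> forall N,
    exists2 n, (N <= n)%N & (M n e' <= T * n)%N) ->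
  exists l : nat -> nat, forall k, [/\ (0 < l k)%N,
    (M (l k) (e / 2 ^+ k.+1) <= T * l k)%N
  & (k.+1 * (l k + 2 * M (l k) (e / 2 ^+ k.+1)).-1 < l k.+1)%N].
Proof.
move=> e0 good.
have [F FP] := choice (fun kN : nat * nat => (exists2P _ _).1
  (good (e / 2 ^+ kN.1.+1) ltac:(by rewrite divr_gt0// exprn_gt0) kN.2)).
pose l := fix l k := if k is j.+1
  then F (k, (k * (l j + 2 * M (l j) (e / 2 ^+ j.+1)).-1).+1) else F (0%N, 1%N).
pose next k := (k.+1 * (l k + 2 * M (l k) (e / 2 ^+ k.+1)).-1).+1.
have lP k : (0 < l k)%N /\ (M (l k) (e / 2 ^+ k.+1) <= T * l k)%N.
  case: k => [|k]; first exact: FP (0%N, 1%N).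
  by have [H ?] := FP (k.+1, next k); split => //; exact: leq_trans H.
exists l => k; have [l0 lM] := lP k; split => //.
by have [H _] := FP (k.+1, next k).
Qed.

End nested_shadowing.

(** * Statistics of shadowing orbits *)

Section birkhoff_sums.
Context {R : realType} {X : pointedMetricType R}.
Variable f : X -> X.
Implicit Types (phi : X -> R) (x y z : X).

Definition birkhoff_sum phi n x : R := \sum_(i < n) phi (iter i f x).

Lemma birkhoff_sumD phi m n x :
  birkhoff_sum phi (m + n) x = birkhoff_sum phi m x + birkhoff_sum phi n (iter m f x).
Proof.
rewrite /birkhoff_sum big_split_ord /=; congr (_ + _).
by apply: eq_bigr => i _; rewrite addnC iterD.
Qed.

Lemma birkhoff_sumS phi n x :
  birkhoff_sum phi n.+1 x = phi x + birkhoff_sum phi n (f x).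
Proof.
by rewrite -add1n birkhoff_sumD; congr (_ + _); rewrite /birkhoff_sum big_ord1.
Qed.

Lemma birkhoff_sum_ge0 phi n x : (forall y, 0 <= phi y) -> 0 <= birkhoff_sum phi n x.
Proof. by move=> phi0; apply: sumr_ge0. Qed.

Lemma le_birkhoff_sum phi m n x : (forall y, 0 <= phi y) -> (m <= n)%N ->
  birkhoff_sum phi m x <= birkhoff_sum phi n x.
Proof.
by move=> phi0 /subnKC <-; rewrite birkhoff_sumD lerDl birkhoff_sum_ge0.
Qed.

Lemma norm_birkhoff_sum_le phi B n x : (forall y, `|phi y| <= B) ->
  `|birkhoff_sum phi n x| <= B * n%:R.
Proof.
move=> phiB; apply: le_trans (ler_norm_sum _ _ _) _.
apply: (@le_trans _ _ (\sum_(i < n) B)); first by apply: ler_sum.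
by rewrite sumr_const card_ord mulr_natr.
Qed.

Lemma birkhoff_sum_shadow phi (d e : R) n x y :
  (forall a b, mdist a b <= d -> `|phi a - phi b| <= e) ->
  (forall i, (i < n)%N -> mdist (iter i f x) (iter i f y) <= d) ->
  `|birkhoff_sum phi n x - birkhoff_sum phi n y| <= e * n%:R.
Proof.
move=> phie xy; rewrite /birkhoff_sum -sumrB.
apply: le_trans (ler_norm_sum _ _ _) _.
apply: (@le_trans _ _ (\sum_(i < n) e)).
  by apply: ler_sum => i _; apply: phie; exact: xy.
by rewrite sumr_const card_ord mulr_natr.
Qed.

Definition birkhoff_converges phi y (A : R) : Prop := forall e, 0 < e ->
  exists N, forall n, (N <= n)%N -> `|birkhoff_sum phi n y - A * n%:R| <= e * n%:R.

End birkhoff_sums.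

Lemma block_lengths_ge (s l : nat -> nat) : (forall k, 0 < l k)%N ->
  (forall k, l k <= s k)%N -> (forall k, k.+1 * s k < l k.+1)%N ->
  forall k, (k < l k)%N.
Proof. by move=> l0 ls sl; elim=> [|k IH] //; have := sl k; have := ls k; nia. Qed.

Section shadowing_statistics.
Context {R : realType} {X : pointedMetricType R}.
Variable f : X -> X.
Hypothesis compactX : compact [set: X].
Variables (e0 : R) (T : nat) (s l : nat -> nat).
Hypotheses (l_gt0 : forall k, (0 < l k)%N).
Hypotheses (ls : forall k, (l k <= s k)%N) (sT : forall k, (s k <= (1 + 2 * T) * l k)%N).
Hypothesis sl : forall k, (k.+1 * s k < l k.+1)%N.

Lemma block_of n : (l 0 <= n)%N -> exists k, (l k <= n < l k.+1)%N.
Proof.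
move=> ln; have [||k lk kmax] := @ex_maxnP (fun k => l k <= n)%N n.
- by exists 0%N.
- by move=> k; apply: leq_trans; exact: ltnW (block_lengths_ge s l l_gt0 ls sl k).
- by exists k; rewrite lk ltnNge; apply/negP => /kmax; rewrite ltnn.
Qed.

Lemma shadow_radius (d : R) : 0 < d -> exists K, forall k, (K <= k)%N -> e0 / 2 ^+ k <= d.
Proof.
move=> d0; exists (Num.truncn (e0 / d)).+1 => k Kk.
rewrite ler_pdivrMr ?exprn_gt0// mulrC -ler_pdivrMr//.
apply: (@le_trans _ _ k%:R); last by rewrite -natrX ler_nat ltnW// ltn_expl.
by apply: ltW; apply: lt_le_trans (truncnS_gt _) _; rewrite ler_nat.
Qed.

Lemma block_shadow (phi : X -> R) (e : R) : continuous phi -> 0 < e ->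
  exists K, forall y z, shadows f e0 s l y z ->
  forall k n, (K <= k)%N -> (s k + n <= l k.+1)%N ->
    `|birkhoff_sum f phi n (y k) - birkhoff_sum f phi n (iter (s k) f z)| <= e * n%:R.
Proof.
move=> cphi e_gt0; have [d d0 dphi] := uniform_continuity compactX phi _ cphi e_gt0.
have [K KP] := shadow_radius _ d0; exists K => y z yz k n Kk nl.
apply: (@birkhoff_sum_shadow _ _ _ _ d) => [a b ab|i i_n].
  by have := dphi a b ab; rewrite /ball /= => /ltW.
rewrite -iterD addnC; apply: le_trans (KP _ Kk).
by have := yz k (s k + i)%N; rewrite addKn; apply; lia.
Qed.

(* [phi >= 0], so the uncontrolled gap before block [k] can only help; it has
   length at most [2 * T * l k], so the controlled times keep a proportion at least
   [1 / (1 + 2 * T)], up to the boundary effects absorbed by the factor 8. *)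
Lemma birkhoff_sum_lower_bound (phi : X -> R) (c : R) (N : nat) :
  continuous phi -> (forall x, 0 <= phi x) -> 0 < c ->
  exists N', forall y z, shadows f e0 s l y z ->
    (forall k n, (N <= n)%N -> c * n%:R <= birkhoff_sum f phi n (y k)) ->
  forall n, (N' <= n)%N ->
    c / (8 * (1 + 2 * T)%:R) * n%:R <= birkhoff_sum f phi n z.
Proof.
move=> cphi phi0 c0.
have [K KP] := block_shadow phi _ cphi (divr_gt0 c0 (ltr0n _ 2)).
(* From this time on the current block has index at least [K + 2 * N + 2], so the block before it is
   already well shadowed, longer than [N], and fills more than half of the past at its end. *)
exists (l (K + 2 * N).+2) => y z yz yN n ln.
have lS k : (l k <= l k.+1)%N by have := sl k; have := ls k; nia.
have lle : {homo l : k j / (k <= j)%N} := homo_leq leqnn leq_trans lS.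
have [k /andP[lk kl]] : exists k, (l k <= n < l k.+1)%N.
  by apply: block_of; rewrite (leq_trans _ ln)// lle.
have : (K + 2 * N + 2 <= k)%N.
  rewrite leqNgt; apply/negP => kK; have : (l k.+1 <= l (K + 2 * N).+2)%N by apply: lle; lia.
  by lia.
case: k lk kl => [|j] lk kl Kj; first by lia.
have blockP i m : (K <= i)%N -> (N <= m)%N -> (s i + m <= l i.+1)%N ->
    c / 2 * m%:R <= birkhoff_sum f phi m (iter (s i) f z).
  move=> Ki Nm sml; have := yN i m Nm; have := KP y z yz i m Ki sml.
  by rewrite ler_norml => /andP[]; lra.
have slj : (2 * s j < l j.+1)%N by have := sl j; nia.
have Nl : (2 * N <= l j.+1)%N by have := block_lengths_ge s l l_gt0 ls sl j.+1; lia.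
have first_block : c / 4 * (l j.+1)%:R <= birkhoff_sum f phi (l j.+1) z.
  have -> : l j.+1 = (s j + (l j.+1 - s j))%N by lia.
  rewrite birkhoff_sumD.
  have := blockP j (l j.+1 - s j)%N ltac:(lia) ltac:(lia) ltac:(lia).
  have := birkhoff_sum_ge0 f phi (s j) z phi0.
  have : (l j.+1)%:R <= 2 * (l j.+1 - s j)%:R :> R by rewrite -natrM ler_nat; lia.
  by rewrite subnKC; last lia; nra.
set C : R := (1 + 2 * T)%:R.
have C0 : 1 <= C by rewrite ler1n.
set q := c / (8 * C); have cE : c = 8 * C * q.
  by rewrite /q mulrC divfK// gt_eqF// mulr_gt0//; lra.
have q0 : 0 < q by rewrite divr_gt0// mulr_gt0//; lra.
have sC : (s j.+1)%:R <= C * (l j.+1)%:R by rewrite -natrM ler_nat.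
(* If the current block has run for at most [N] steps, then [n <= 2 * s j.+1 <= 2 * C * l j.+1], and
   the bound [c / 4] at time [l j.+1] suffices; this produces the denominator [8 * C]. *)
have [ns|sn] := leqP n (s j.+1 + N).
  apply: le_trans (le_birkhoff_sum f phi _ _ z phi0 lk).
  apply: le_trans first_block; rewrite cE.
  have : n%:R <= 2 * (s j.+1)%:R :> R.
    by rewrite -natrM ler_nat; have := ls j.+1; lia.
  by nra.
have -> : n = (s j.+1 + (n - s j.+1))%N by lia.
rewrite birkhoff_sumD natrD.
have := blockP j.+1 (n - s j.+1)%N ltac:(lia) ltac:(lia) ltac:(lia).
have := le_birkhoff_sum f phi _ _ z phi0 (ls j.+1).
have : 0 <= (n - s j.+1)%:R :> R by [].
have qs := ler_wpM2l (ltW q0) sC.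
move: (_ - _)%:R first_block => r; rewrite cE => bl r0.
have := ler_wpM2l (ltW q0) (ler_peMl r0 C0); have := mulr_ge0 (ltW q0) r0.
have : 0 <= C * q * (l j.+1)%:R.
  by apply: mulr_ge0 => //; apply: mulr_ge0; [exact: le_trans C0|exact: ltW].
by lra.
Qed.

(** Block [k] starts before the fraction [1/(k+1)] of the time [l k.+1], so the past is negligible,
    and inside the block the sums are those of [y0] up to the shadowing error. *)
Lemma birkhoff_sum_block_end (phi : X -> R) (A : R) (y0 : X) :
  continuous phi -> birkhoff_converges f phi y0 A ->
  forall e, 0 < e -> exists K, forall y z, shadows f e0 s l y z ->
  forall k, (K <= k)%N -> y k = y0 ->
    `|birkhoff_sum f phi (l k.+1) z - A * (l k.+1)%:R| <= e * (l k.+1)%:R.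
Proof.
move=> cphi yA e e_gt0; have e3 : 0 < e / 4 by rewrite divr_gt0.
have [K KP] := block_shadow phi _ cphi e3.
have [N NP] := yA _ e3.
have [B B0 phiB] := continuous_bounded compactX phi cphi.
have BA : 0 < B + `|A| by rewrite ltr_pwDl.
(* For [k >= D] the time before the block costs at most [e / 4] per unit of [l k.+1]; shadowing and
   convergence at [y0] cost [e / 4] each. *)
set D := (Num.truncn ((B + `|A|) / (e / 4))).+1.
have DP : B + `|A| <= e / 4 * D%:R.
  by rewrite mulrC -ler_pdivrMr// ltW// truncnS_gt.
exists (K + 2 * N + D).+1 => y z yz k Kk yk.
set L := l k.+1; set S := s k.
have SL : (k.+1 * S < L)%N := sl k.
have NL : (2 * N <= L)%N by have := block_lengths_ge s l l_gt0 ls sl k.+1; rewrite /L; lia.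
have SL2 : (2 * S < L)%N by nia.
have := KP y z yz k (L - S)%N ltac:(lia) ltac:(rewrite /L /S; lia).
have := NP (L - S)%N ltac:(lia); rewrite -yk.
have LE : L = (S + (L - S))%N by lia.
have SD : (B + `|A|) * S%:R <= e / 4 * L%:R.
  have DSL : D%:R * S%:R <= L%:R :> R.
    by rewrite -natrM ler_nat; move: SL; rewrite /S /L; nia.
  by have := ler_wpM2r (ler0n R S) DP; have := ler_wpM2l (ltW e3) DSL; rewrite /=; lra.
have -> : birkhoff_sum f phi L z = birkhoff_sum f phi S z +
    birkhoff_sum f phi (L - S) (iter S f z) by rewrite {1}LE birkhoff_sumD.
have := norm_birkhoff_sum_le f phi B S z phiB.
have LR : L%:R = S%:R + (L - S)%:R :> R by rewrite -natrD -LE.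
have S0 : 0 <= S%:R :> R by [].
have r0 : 0 <= (L - S)%:R :> R by [].
have := ler_norm A; have := ler_norm (- A); rewrite normrN.
rewrite LR in SD *; move: (S%:R) S0 r0 SD => S' S0 r0 SD.
move: (_%:R) r0 SD => r r0 SD.
set a := birkhoff_sum _ _ _ (y k); set b := birkhoff_sum _ _ S z.
set c := birkhoff_sum _ _ _ (iter _ _ _).
move=> A1 A2 /ler_normlP[b1 b2] /ler_normlP[a1 a2] /ler_normlP[c1 c2].
by apply/ler_normlP; split; nra.
Qed.

End shadowing_statistics.

(** * A distal pair *)

Section distal_pair.
Context {R : realType} {X : pointedMetricType R}.
Variables (f : X -> X) (M : nat -> R -> nat).
Hypotheses (compactX : compact [set: X]) (cont_f : continuous f).
Hypothesis specM : nonuniform_specification f M.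

Lemma finite_forall_nat (n : nat) (P : 'I_n -> nat -> Prop) :
  (forall j a b, (a <= b)%N -> P j a -> P j b) ->
  (forall j, exists a, P j a) -> exists a, forall j, P j a.
Proof.
move=> mono /choice[F FP]; exists (\max_j F j)%N => j.
exact: mono (leq_bigmax j) (FP j).
Qed.

Lemma equi_uniform_continuity (n : nat) (g : 'I_n -> X -> R) (e : R) :
  (forall j, continuous (g j)) -> 0 < e ->
  exists2 d, 0 < d & forall j x y, mdist x y <= d -> `|g j x - g j y| <= e.
Proof.
move=> cg e0; have [N NP] : exists N : nat, forall j x y,
    mdist x y <= N.+1%:R^-1 -> `|g j x - g j y| <= e.
  apply: (@finite_forall_nat n (fun j N => forall x y,
      mdist x y <= N.+1%:R^-1 -> `|g j x - g j y| <= e)).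
    move=> j a b ab H x y xy; apply: H; apply: le_trans xy _.
    by rewrite lef_pV2 ?posrE// ler_nat.
  move=> j; have [d d0 H] := uniform_continuity compactX (g j) _ (cg j) e0.
  exists (Num.truncn d^-1) => x y xy; apply: ltW; apply: H.
  apply: le_trans xy _; rewrite -[leRHS]invrK lef_pV2 ?posrE ?invr_gt0//.
  by rewrite ltW// truncnS_gt.
by exists N.+1%:R^-1 => [|//]; rewrite invr_gt0.
Qed.

(* Start of the [i]-th segment: even indices are the blocks of length [L], odd indices
   the single visit placed in the middle of the gap. *)
Definition periodic_block (L G i : nat) : nat :=
  (i./2 * (L + 2 * G).-1 + odd i * (L + G).-1)%N.

(** Pieces of the orbit of [y] alternate with visits to [p], all gaps being exactly [M L e]. The
    visiting times do not depend on [p], so points built for two different targets can be compared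
    at these times. *)
Lemma periodic_specification (e : R) (L : nat) (y p : X) :
  0 < e -> (0 < L)%N ->
  exists w, forall h,
    (forall n, (n < L)%N ->
      mdist (iter n f y) (iter (h * (L + 2 * M L e).-1 + n) f w) <= e) /\
    mdist p (iter (h * (L + 2 * M L e).-1 + (L + M L e).-1) f w) <= e.
Proof.
move=> e0 L0; have [[M0 Mn _] _] := specM.
have G0 := M0 L e L0 e0; have M1L : (M 1 e <= M L e)%N by exact: Mn.
set G := M L e in G0 M1L *; set P := (L + 2 * G).-1.
pose a := periodic_block L G.
pose b i := (a i + (if odd i then 0 else L.-1))%N.
have aS i : a i.+1 = (b i + G)%N.
  rewrite /b /a /periodic_block /= uphalf_half; case: (odd i) => /=; last by lia.
  by rewrite add1n mulSn; lia.
have [|||w wP] := infinite_specification f M compactX cont_f specM e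
  (fun i => if odd i then p else y) a b e0.
- by move=> i; rewrite /b leq_addr.
- by move=> i; rewrite aS; lia.
- move=> i; rewrite aS addKn /b addKn; case: odd => //.
  by rewrite addn1 prednK.
exists w => h; have a0 : a (2 * h)%N = (h * P)%N.
  by rewrite /a /periodic_block mul2n doubleK odd_double mul0n addn0.
have a1 : a (2 * h).+1 = (h * P + (L + G).-1)%N.
  by rewrite /a /periodic_block mul2n /= uphalf_double odd_double mul1n.
split.
  move=> n nL; have := wP (2 * h)%N (h * P + n)%N.
  by rewrite /b a0 mul2n odd_double addKn; apply; lia.
have := wP (2 * h).+1 (h * P + (L + G).-1)%N.
by rewrite /b a1 /= mul2n odd_double /= subnn; apply; lia.
Qed.

Lemma periodic_birkhoff_sum (phi : X -> R) (c e : R) (L P C : nat) (y w : X) :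
  (forall x, 0 <= phi x) -> 0 < c -> (0 < L)%N -> (L <= P)%N -> (P <= C * L)%N ->
  (forall a b, mdist a b <= e -> `|phi a - phi b| <= c / 2) ->
  c * L%:R <= birkhoff_sum f phi L y ->
  (forall h n, (n < L)%N ->
      mdist (iter n f y) (iter (h * P + n) f w) <= e) ->
  exists N, forall n, (N <= n)%N ->
    c / (4 * C%:R) * n%:R <= birkhoff_sum f phi n w.
Proof.
move=> phi0 c0 L0 LP PC phie cL yw.
have blocks h : (c / 2 * L%:R) * h%:R <= birkhoff_sum f phi (h * P) w.
  elim: h => [|h IH]; first by rewrite mulr0 birkhoff_sum_ge0.
  rewrite mulSnr birkhoff_sumD -(natr1 h) mulrDr mulr1 lerD//.
  apply: le_trans (le_birkhoff_sum f phi _ _ _ phi0 LP).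
  have xy i : (i < L)%N -> mdist (iter i f y) (iter i f (iter (h * P) f w)) <= e.
    by move=> iL; rewrite -iterD addnC; exact: yw.
  have := birkhoff_sum_shadow f phi e (c / 2) L _ _ phie xy.
  by rewrite ler_norml => /andP[]; lra.
exists P => n Pn; set h := (n %/ P)%N.
have P0 : (0 < P)%N by lia.
(* Since [h >= 1], [n < (h + 1) * P <= 2 * h * P]. With [P <= C * L] and the loss from [c] to
   [c / 2] by shadowing, this gives the denominator [4 * C]. *)
have nh : (n <= 2 * (h * C * L))%N.
  have := divn_eq n P; have := ltn_pmod n P0; rewrite -/h => h1 h2.
  have : (0 < h)%N by rewrite divn_gt0.
  by nia.
apply: le_trans (le_birkhoff_sum f phi _ _ w phi0 (leq_trunc_div n P)).
apply: le_trans (blocks h).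
have C0 : 0 < C%:R :> R by rewrite ltr0n; nia.
have : n%:R <= 2 * (h%:R * C%:R * L%:R) :> R by rewrite -!natrM ler_nat.
set q := c / _; have cE : c = 4 * C%:R * q.
  by rewrite /q mulrC divfK// gt_eqF// mulr_gt0.
have q0 : 0 < q by rewrite divr_gt0// mulr_gt0.
by move=> nR; have := ler_wpM2l (ltW q0) nR; rewrite /= cE; lra.
Qed.

(* Both points follow [y] during a fixed proportion of the time, but one visits
   [p] when the other visits [q], at times with bounded gaps; uniform continuity of the
   iterates of [f] then keeps the two orbits apart at all times. *)
Lemma distal_pair (T n : nat) (g : 'I_n -> X -> R) (c : R) (y p q : X) :
  (forall e' : R, 0 < e' -> forall N,
    exists2 n, (N <= n)%N & (M n e' <= T * n)%N) ->
  p <> q -> (forall j, continuous (g j)) -> (forall j x, 0 <= g j x) -> 0 < c ->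
  (forall j, exists N, forall k, (N <= k)%N -> c * k%:R <= birkhoff_sum f (g j) k y) ->
  exists (w : bool -> X) (t : R), [/\ 0 < t,
    forall k, t <= mdist (iter k f (w false)) (iter k f (w true))
  & forall j b, exists N, forall k, (N <= k)%N ->
      c / (4 * (1 + 2 * T)%:R) * k%:R <= birkhoff_sum f (g j) k (w b)].
Proof.
move=> good /eqP; rewrite -mdist_gt0 => pq cg g0 c0 gy.
have [d d0 dg] := equi_uniform_continuity _ _ _ cg (divr_gt0 c0 (ltr0n _ 2)).
(* The first bound preserves the averages of the [g j]; the second leaves the two orbits at least
   [mdist p q / 2] apart at visiting times. *)
set e := Num.min d (mdist p q / 4).
have e0 : 0 < e by rewrite lt_min d0 divr_gt0.
have [N NP] := @finite_forall_nat n
  (fun j N => forall k, (N <= k)%N -> c * k%:R <= birkhoff_sum f (g j) k y)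
  (fun j a b ab H k bk => H k (leq_trans ab bk)) gy.
have [L NL MT] := good e e0 N.+1.
have L0 : (0 < L)%N by exact: leq_ltn_trans NL.
have [[M0 _ _] _] := specM; have G0 := M0 L e L0 e0.
have [w wP] := choice (fun b : bool => periodic_specification e L y
  (if b then q else p) e0 L0).
set P := (L + 2 * M L e).-1 in wP; exists w.
have [t t0 tP] := uniform_continuity_iter compactX f (2 * P) _ cont_f
  (divr_gt0 pq (ltr0n _ 2)).
exists t; split => // [k|j b].
  rewrite leNgt; apply/negP => kt.
  (* The visiting time in the period following the one that contains [k], at most [2 * P] steps
     after [k]. *)
  pose m := ((k %/ P).+1 * P + (L + M L e).-1)%N.
  have km : (k <= m <= k + 2 * P)%N.
    have := divn_eq k P; have := ltn_pmod k (_ : 0 < P)%N.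
    by rewrite /m /P mulSn; lia.
  have mk : (m - k <= 2 * P)%N by move: km; clear; lia.
  have := tP (m - k)%N _ _ mk (ltW kt).
  rewrite -!iterD subnK; last by case/andP: km.
  have [_] := wP false (k %/ P).+1; have [_] := wP true (k %/ P).+1; rewrite -/m.
  have : e <= mdist p q / 4 by rewrite ge_min lexx orbT.
  have := metric_triangle p (iter m f (w false)) q.
  have := metric_triangle (iter m f (w false)) (iter m f (w true)) q.
  rewrite (metric_sym (iter m f (w true)) q); clear; lra.
apply: (@periodic_birkhoff_sum (g j) c e L P _ y (w b)) => //.
- by rewrite /P; lia.
- by rewrite /P; lia.
- by move=> a a' aa'; apply: dg; rewrite (le_trans aa')// ge_min lexx.
- by apply: NP; exact: ltnW.
- by move=> h; have [] := wP b h.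
Qed.

End distal_pair.

(** * Integrals of bounded functions *)

Section bounded_integrals.
Context {R : realType} {X : pointedMetricType R}.
Implicit Types (mu : probability (borel X) R) (h phi : X -> R).

Definition bounded_measurable h : Prop :=
  measurable_fun [set: borel X] (h : borel X -> R) /\ exists B, forall x, `|h x| <= B.

Lemma open_borel (W : set X) : open W -> measurable (W : set (borel X)).
Proof. by move=> oW; exact: sub_sigma_algebra. Qed.

Lemma continuous_measurable h :
  continuous h -> measurable_fun [set: borel X] (h : borel X -> R).
Proof.
move=> /continuousP ch; apply: (measurability _ (RGenOpens.measurableE R)).
move=> _ [_ [a [b ->] <-]]; rewrite setTI; apply: open_borel.
exact/ch/interval_open.
Qed.

Lemma continuous_bounded_measurable h : compact [set: X] ->
  continuous h -> bounded_measurable h.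
Proof.
move=> compactX ch; split; first exact: continuous_measurable.
by have [B _ hB] := continuous_bounded compactX h ch; exists B.
Qed.

Lemma bounded_measurable_integrable mu h :
  bounded_measurable h -> mu.-integrable setT (EFin \o (h : borel X -> R)).
Proof.
move=> [mh [B hB]]; apply: measurable_bounded_integrable => //.
  by rewrite (le_lt_trans (probability_le1 mu _))// ltry.
exists B; split; first exact: num_real.
by move=> B' BB' x _; apply: le_trans (hB x) (ltW BB').
Qed.

Lemma bounded_measurableD h1 h2 : bounded_measurable h1 -> bounded_measurable h2 ->
  bounded_measurable (fun x => h1 x + h2 x).
Proof.
move=> [m1 [B1 hB1]] [m2 [B2 hB2]]; split; first exact: measurable_funD.
by exists (B1 + B2) => x; rewrite (le_trans (ler_normD _ _))// lerD.
Qed.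

Lemma bounded_measurableZ (a : R) h : bounded_measurable h ->
  bounded_measurable (fun x => a * h x).
Proof.
move=> [m1 [B hB]]; split; first exact: measurable_funM.
by exists (`|a| * B) => x; rewrite normrM ler_wpM2l.
Qed.

Lemma bounded_measurable_cst (a : R) : bounded_measurable (fun=> a).
Proof. by split; [exact: measurable_cst|exists `|a|]. Qed.

Lemma bounded_measurable_indic (A : set X) : measurable (A : set (borel X)) ->
  bounded_measurable (\1_A : X -> R).
Proof.
move=> mA; split; first exact: measurable_indic.
by exists 1 => x; rewrite indicE; case: (_ \in _); rewrite ?normr1 ?normr0.
Qed.

Lemma Rintegral_prob_cst mu (a : R) : \int[mu]_x a = a.
Proof.
rewrite Rintegral_cst//; have H := @probability_setT _ _ _ mu.
by rewrite [X in fine X]H mulr1.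
Qed.

Lemma Rintegral_invariant (f : X -> X) mu h : continuous f -> invariant_measure f mu ->
  bounded_measurable h -> \int[mu]_x h (f x) = \int[mu]_x h x.
Proof.
move=> cf inv bh.
have mf : measurable_fun [set: borel X] (f : borel X -> borel X).
  apply: (measurability _ (erefl : @measurable _ (borel X) = <<s @open X >>)).
  move=> _ [W oW <-]; rewrite setTI; apply: open_borel.
  by move/continuousP: cf; exact.
have mh : measurable_fun [set: borel X] (EFin \o (h : borel X -> R)).
  by apply/measurable_EFinP; case: bh.
have bhf : bounded_measurable (h \o f).
  by case: bh => m1 [B hB]; split; [exact: (measurableT_comp m1 mf)|exists B => x; exact: hB].
congr fine.
have := @integral_pushforward _ _ _ _ R _ mf mu setT _ mh
  (bounded_measurable_integrable mu _ bhf) measurableT.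
rewrite preimage_setT => <-.
by apply: eq_measure_integral => A mA _; exact: inv.
Qed.

Lemma bounded_convergence mu (h_ : nat -> X -> R) h (B : R) :
  (forall n, measurable_fun [set: borel X] (h_ n : borel X -> R)) ->
  measurable_fun [set: borel X] (h : borel X -> R) ->
  (forall n x, `|h_ n x| <= B) ->
  (\forall x \ae mu, (h_ n (x : X)) @[n --> \oo] --> h x) ->
  \int[mu]_x h_ n x @[n --> \oo] --> \int[mu]_x h x.
Proof.
move=> mh_ mh hB h_h.
have iB : mu.-integrable setT (EFin \o (fun _ : borel X => B)).
  by apply: bounded_measurable_integrable; exact: bounded_measurable_cst.
have [||||ih _ H] := @dominated_convergence _ _ R mu setT measurableT
  (fun n x => (h_ n x)%:E) (fun x => (h x)%:E) _ _ _ _ iB.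
- by move=> n; apply/measurable_EFinP.
- by apply/measurable_EFinP.
- apply: filterS h_h; first exact: (ae_filter_ringOfSetsType mu).
  by move=> x hx _; apply: cvg_EFin; [exact: nearW|exact: hx].
- by apply: aeW => x n _; rewrite /= lee_fin.
apply: fine_cvg; rewrite fineK //.
exact: integrable_fin_num.
Qed.

End bounded_integrals.

(** * The ergodic theorem *)

Section continuous_functions.
Context {R : realType} {X : topologicalType}.
Implicit Types h : X -> R.

Lemma continuous_add h1 h2 :
  continuous h1 -> continuous h2 -> continuous (fun x => h1 x + h2 x).
Proof. by move=> c1 c2 x; apply: cvgD; [exact: c1|exact: c2]. Qed.

Lemma continuous_scale (a : R) h : continuous h -> continuous (fun x => a * h x).
Proof. by move=> ch x; apply: cvgM; [exact: cvg_cst|exact: ch]. Qed.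

Lemma continuous_sum (I : Type) (s : seq I) (h : I -> X -> R) :
  (forall i, continuous (h i)) -> continuous (fun x => \sum_(i <- s) h i x).
Proof.
move=> ch; elim: s => [|i s IH].
  by under eq_fun do rewrite big_nil; move=> x; exact: cvg_cst.
by under eq_fun do rewrite big_cons; exact: continuous_add.
Qed.

Lemma continuous_max0 h : continuous h -> continuous (fun x => Num.max 0 (h x)).
Proof.
move=> ch x; apply: (@continuous_max R X (fun=> 0) h); first exact: cvg_cst.
exact: ch.
Qed.

End continuous_functions.

Section ergodic_theorem.
Context {R : realType} {X : pointedMetricType R}.
Variable f : X -> X.
Hypotheses (compactX : compact [set: X]) (cont_f : continuous f).
Implicit Types (mu : probability (borel X) R) (phi : X -> R).

Lemma continuous_birkhoff_sum phi n :
  continuous phi -> continuous (birkhoff_sum f phi n).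
Proof.
move=> cphi; rewrite /birkhoff_sum.
apply: (@continuous_sum _ _ 'I_n _ (fun i x => phi (iter i f x))) => i x.
by apply: continuous_comp; [exact: continuous_iter|exact: cphi].
Qed.

(** The maximum of the Birkhoff sums of lengths [0] to [n], in a recursive form suited to comparing
    [x] with [f x]. *)
Fixpoint max_birkhoff_sum phi (n : nat) (x : X) : R :=
  if n is n'.+1 then Num.max 0 (phi x + max_birkhoff_sum phi n' (f x)) else 0.

Lemma max_birkhoff_sum_ge0 phi n x : 0 <= max_birkhoff_sum phi n x.
Proof. by case: n => [//|n] /=; rewrite le_max lexx. Qed.

Lemma max_birkhoff_sumS phi n x :
  max_birkhoff_sum phi n x <= max_birkhoff_sum phi n.+1 x.
Proof.
elim: n x => [|n IH] x; first exact: max_birkhoff_sum_ge0.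
rewrite [max_birkhoff_sum _ n.+1 _]/= [leRHS]/=.
by rewrite ge_max !le_max lexx /= lerD2l IH orbT.
Qed.

Lemma max_birkhoff_sum_homo phi m n x : (m <= n)%N ->
  max_birkhoff_sum phi m x <= max_birkhoff_sum phi n x.
Proof.
have := @homo_leq _ (max_birkhoff_sum phi ^~ x) <=%R lexx le_trans.
by apply=> k; exact: max_birkhoff_sumS.
Qed.

Lemma birkhoff_sum_le_max phi n x : birkhoff_sum f phi n x <= max_birkhoff_sum phi n x.
Proof.
elim: n x => [|n IH] x; first by rewrite /birkhoff_sum big_ord0.
by rewrite birkhoff_sumS /= le_max lerD2l IH orbT.
Qed.

Lemma continuous_max_birkhoff_sum phi n :
  continuous phi -> continuous (max_birkhoff_sum phi n).
Proof.
move=> cphi; elim: n => [|n IH] /=; first by move=> x; exact: cvg_cst.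
apply: continuous_max0; apply: continuous_add => // x.
by apply: continuous_comp; [exact: cont_f|exact: IH].
Qed.

(* Where [F := max_birkhoff_sum phi n] is positive, [F <= phi + F \o f]. *)
Lemma maximal_inequality mu phi (B : R) n :
  invariant_measure f mu -> continuous phi -> (forall x, `|phi x| <= B) ->
  - B * \int[mu]_x \1_[set x | max_birkhoff_sum phi n x <= 0] x <= \int[mu]_x phi x.
Proof.
move=> inv cphi phiB; set F := max_birkhoff_sum phi n.
have cF : continuous F by exact: continuous_max_birkhoff_sum.
set E := [set x | _].
have mE : measurable (E : set (borel X)).
  rewrite -[E]setCK; apply: measurableC; apply: open_borel.
  rewrite (_ : ~` E = F @^-1` [set r | 0 < r]); last first.
    by apply/seteqP; split => x; rewrite /E /= ltNge => /negP.
  by move/continuousP: cF; apply; exact: open_gt.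
have bF : bounded_measurable F by exact: continuous_bounded_measurable.
have bFf : bounded_measurable (F \o f).
  apply: continuous_bounded_measurable => // x.
  by apply: continuous_comp; [exact: cont_f|exact: cF].
have bE := bounded_measurable_indic E mE.
have bphi : bounded_measurable phi by exact: continuous_bounded_measurable.
have bN1 := bounded_measurableZ (- 1) (F \o f) bFf.
have bN2 := bounded_measurableZ (- B) \1_E bE.
have bS := bounded_measurableD _ _ bF bN1.
(* By invariance [F - F \o f] has integral zero; adding it reduces the claim to a pointwise
   inequality. *)
have -> : - B * \int[mu]_x \1_E x =
    \int[mu]_x ((F x + -1 * F (f x)) + - B * \1_E x).
  rewrite RintegralD//; try exact: bounded_measurable_integrable.
  rewrite RintegralD//; try exact: bounded_measurable_integrable.
  rewrite !RintegralZl//; try exact: bounded_measurable_integrable.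
  by rewrite (Rintegral_invariant f mu F)// mulN1r subrr add0r.
apply: le_Rintegral => //; try apply: bounded_measurable_integrable => //.
  exact: bounded_measurableD.
move=> x _; rewrite indicE.
have := phiB x; rewrite ler_norml => /andP[phix _].
have [xE|xE] := boolP (x \in E).
  have := max_birkhoff_sum_ge0 phi n (f x); rewrite -/F.
  by move/set_mem: xE; rewrite /E /=; lra.
have {xE} : 0 < F x by rewrite ltNge; apply/negP => xE'; move/negP: xE; apply; apply/mem_set.
rewrite /F; case: (n) => [|n']; first by rewrite ltxx.
move=> F0; suff : max_birkhoff_sum phi n'.+1 x <= phi x + max_birkhoff_sum phi n'.+1 (f x).
  by rewrite mulr0 addr0; lra.
have E1 : max_birkhoff_sum phi n'.+1 x =
  Num.max 0 (phi x + max_birkhoff_sum phi n' (f x)) by [].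
rewrite E1 lt_max ltxx /= in F0.
by rewrite E1 (max_r (ltW F0)) lerD2l max_birkhoff_sumS.
Qed.

(** The points with sums unbounded above form an invariant set. If it had full measure,
    [max_birkhoff_sum] would become positive almost everywhere, and [maximal_inequality] would give
    a nonnegative integral in the limit. *)
Lemma ergodic_birkhoff_bounded mu phi :
  ergodic_measure f mu -> continuous phi -> \int[mu]_x phi x < 0 ->
  \forall x \ae mu, exists K : nat, forall n, birkhoff_sum f phi n x <= K%:R.
Proof.
move=> [inv erg] cphi phi_lt0.
have [B B0 phiB] := continuous_bounded compactX phi cphi.
(* Unlike superlevel sets of the limsup of the averages, [A] is invariant for a
   trivial reason: its defining property ignores bounded errors. *)
pose A : set X := [set x | forall K : nat, exists n, K%:R < birkhoff_sum f phi n x].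
have mA : measurable (A : set (borel X)).
  rewrite (_ : A = \bigcap_K \bigcup_n
      birkhoff_sum f phi n @^-1` [set r | K%:R < r]); last first.
    apply/seteqP; split => x.
      by move=> Ax K _; have [n ?] := Ax K; exists n.
    by move=> Ax K; have [n _ ?] := Ax K I; exists n.
  apply: bigcapT_measurable => K; apply: bigcupT_measurable => n.
  apply: open_borel; have /continuousP := continuous_birkhoff_sum phi n cphi.
  by apply; exact: open_gt.
have fA : f @^-1` A = A.
  apply/seteqP; split => x /= Ax K.
    have [n Kn] := Ax (Num.truncn (K%:R + B)).+1.
    exists n.+1; rewrite birkhoff_sumS.
    have := phiB x; rewrite ler_norml => /andP[].
    by have := truncnS_gt (K%:R + B); lra.
  have [[|n] Kn] := Ax (Num.truncn (K%:R + B)).+1.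
    by move: Kn; rewrite /birkhoff_sum big_ord0 ltNge ler0n.
  exists n; move: Kn; rewrite birkhoff_sumS.
  have := phiB x; rewrite ler_norml => /andP[].
  by have := truncnS_gt (K%:R + B); lra.
have nAP x : ~ A x -> exists K : nat, forall n, birkhoff_sum f phi n x <= K%:R.
  move=> nAx; apply: contrapT => nK; apply: nAx => K; apply: contrapT => nn.
  apply: nK; exists K => n; rewrite leNgt; apply/negP => Kn; apply: nn.
  by exists n.
have [muA|muA] := erg A mA fA.
  exists A; split => // x /= nx; apply: contrapT => /nAP; exact: nx.
suff : 0 <= \int[mu]_x phi x by rewrite leNgt phi_lt0.
pose h_ n : X -> R := \1_[set x | max_birkhoff_sum phi n x <= 0].
have mh_ n : measurable_fun [set: borel X] (h_ n : borel X -> R).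
  apply: measurable_indic; rewrite -[X in measurable X]setCK; apply: measurableC.
  apply: open_borel; rewrite (_ : ~` _ = max_birkhoff_sum phi n @^-1` [set r | 0 < r]).
    have /continuousP := continuous_max_birkhoff_sum phi n cphi.
    by apply; exact: open_gt.
  by apply/seteqP; split => x; rewrite /= ltNge => /negP.
have h_0 : \int[mu]_x h_ n x @[n --> \oo] --> (0 : R).
  rewrite -[X in _ --> X](Rintegral_prob_cst mu).
  apply: (@bounded_convergence _ _ mu h_ (fun=> 0) 1) => //.
    by move=> n x; rewrite /h_ indicE; case: (_ \in _); rewrite ?normr1 ?normr0.
  exists (~` A); split.
  - exact: measurableC.
  - by have := @probability_setC _ _ _ mu A mA; rewrite muA subee.
  - move=> x nx Ax; apply: nx; have [N NP] := Ax 0%N.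
    apply: cvg_near_cst; exists N => // n /= Nn.
    rewrite /h_ indicE memNset// /= => F0; move: NP; apply/negP; rewrite -leNgt.
    apply: le_trans (birkhoff_sum_le_max _ _ _) _.
    exact: le_trans (max_birkhoff_sum_homo _ _ _ _ Nn) F0.
have : (- B * \int[mu]_x h_ n x) @[n --> \oo] --> - B * 0.
  by apply: cvgM => //; exact: cvg_cst.
rewrite mulr0 => H; apply: (closed_cvg (fun r => r <= \int[mu]_x phi x)) H.
  exact: closed_le.
by apply: nearW => n; exact: maximal_inequality.
Qed.

Lemma birkhoff_sum_affine phi (a b : R) n x :
  birkhoff_sum f (fun y => a * phi y + b) n x = a * birkhoff_sum f phi n x + b * n%:R.
Proof.
by rewrite /birkhoff_sum big_split /= mulr_sumr sumr_const card_ord mulr_natr.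
Qed.

(** [ergodic_birkhoff_bounded] is applied to [phi - A] and [A - phi], each lowered by [1/(q+1)] to
    make its integral negative. Bounded sums vanish after division by [n], and there are countably
    many [q]. *)
Lemma ergodic_birkhoff mu phi : ergodic_measure f mu -> continuous phi ->
  \forall x \ae mu, birkhoff_converges f phi x (\int[mu]_x phi x).
Proof.
move=> erg cphi; set A := \int[mu]_x phi x.
have iphi : mu.-integrable setT (EFin \o (phi : borel X -> R)).
  by apply: bounded_measurable_integrable; exact: continuous_bounded_measurable.
have one_sided (a : R) (q : nat) : \forall x \ae mu, exists K : nat, forall n,
    a * birkhoff_sum f phi n x - (a * A + q.+1%:R^-1) * n%:R <= K%:R.
  have cg : continuous (fun y => a * phi y + - (a * A + q.+1%:R^-1)).
    by apply: continuous_add; [exact: continuous_scale|move=> x; exact: cvg_cst].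
  have : \int[mu]_x (a * phi x + - (a * A + q.+1%:R^-1)) < 0.
    rewrite RintegralD//; first last.
    - by apply: bounded_measurable_integrable; exact: bounded_measurable_cst.
    - apply: bounded_measurable_integrable; apply: bounded_measurableZ.
      exact: continuous_bounded_measurable.
    by rewrite RintegralZl// Rintegral_prob_cst -/A opprD addrA subrr add0r oppr_lt0.
  move/(ergodic_birkhoff_bounded mu _ erg cg).
  apply: filterS; first exact: (ae_filter_ringOfSetsType mu).
  move=> x [K KP]; exists K => n; have := KP n.
  by rewrite (birkhoff_sum_affine phi a (- (a * A + q.+1%:R^-1))) mulNr.
have FF := ae_filter_ringOfSetsType mu.
apply: (@filterS _ _ FF _ _ _ (@filterI _ _ FF _ _
  (ae_foralln (one_sided 1)) (ae_foralln (one_sided (-1))))).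
move=> x [Hp Hm] e e0; set q := Num.truncn (2 / e).
have qe : q.+1%:R^-1 <= e / 2.
  by rewrite -[leRHS]invrK lef_pV2 ?posrE ?invr_gt0 ?divr_gt0// invf_div ltW// truncnS_gt.
have [K1 K1P] := Hp q; have [K2 K2P] := Hm q.
exists (Num.truncn ((K1%:R + K2%:R) / (e / 2))).+1 => n Kn.
have Kne : K1%:R + K2%:R <= e / 2 * n%:R.
  rewrite mulrC -ler_pdivrMr ?divr_gt0//; apply/ltW.
  by apply: lt_le_trans (truncnS_gt _) _; rewrite ler_nat.
have qn : q.+1%:R^-1 * n%:R <= e / 2 * n%:R by apply: ler_wpM2r.
have := K1P n; have := K2P n; move: qn; move: (q.+1%:R^-1) => r.
have : 0 <= K1%:R :> R by []. have : 0 <= K2%:R :> R by [].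
by move=> k2 k1 qn h1 h2; apply/ler_normlP; split; move: (n%:R) Kne qn h1 h2 => N; lra.
Qed.

End ergodic_theorem.

(** * Generic points and separation of ergodic measures *)

Section partition_of_unity.
Context {R : realType} {X : pointedMetricType R}.
Hypothesis compactX : compact [set: X].

(** Normalised tent functions on a finite net. For [e = 1/(j+1)] they form a countable family of
    test functions whose combinations approximate every continuous function uniformly. *)
Lemma partition_of_unity (e : R) : 0 < e ->
  exists (n : nat) (a : nat -> X) (psi : nat -> X -> R),
  [/\ forall i, continuous (psi i), forall i x, 0 <= psi i x,
    forall x, \sum_(i < n) psi i x = 1
  & forall i x, psi i x != 0 -> mdist (a i) x < e].
Proof.
move=> e0; have [s sP] := finite_net compactX e e0.
pose a i := nth point s i; pose h i x := Num.max 0 (e - mdist (a i) x).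
have h0 i x : 0 <= h i x by rewrite /h le_max lexx.
have ch i : continuous (h i).
  apply: continuous_max0; apply: continuous_add; first by move=> x; exact: cvg_cst.
  by move=> x; apply: cvgN; exact: continuous_mdist.
pose H x := \sum_(i < size s) h i x.
have H0 x : 0 < H x.
  have [y ys yx] := sP x; rewrite -index_mem in ys.
  rewrite /H (bigD1 (Ordinal ys)) //= ltr_pwDl ?sumr_ge0//.
  by rewrite /h /a nth_index -?index_mem// lt_max subr_gt0 yx orbT.
exists (size s), a, (fun i x => h i x / H x); split.
- move=> i x; apply: cvgM; first exact: ch.
  by apply: cvgV; [rewrite gt_eqF|exact: (@continuous_sum _ _ 'I_(size s) _ h)].
- by move=> i x; rewrite divr_ge0// ltW.
- by move=> x; rewrite -mulr_suml -/(H x) divff ?gt_eqF.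
- move=> i x; apply: contraR; rewrite -leNgt => ex; rewrite mulf_eq0.
  by rewrite /h max_l ?eqxx// subr_le0.
Qed.

Lemma partition_of_unity_approx (phi : X -> R) (d e : R) n (a : nat -> X)
    (psi : nat -> X -> R) x :
  (forall y z, mdist y z < d -> `|phi y - phi z| <= e) ->
  (forall i y, 0 <= psi i y) -> \sum_(i < n) psi i x = 1 ->
  (forall i y, psi i y != 0 -> mdist (a i) y < d) ->
  `|phi x - \sum_(i < n) phi (a i) * psi i x| <= e.
Proof.
move=> phie psi0 psi1 psid.
have -> : phi x - \sum_(i < n) phi (a i) * psi i x =
    \sum_(i < n) (phi x - phi (a i)) * psi i x.
  under [RHS]eq_bigr do rewrite mulrBl.
  by rewrite sumrB -mulr_sumr psi1 mulr1.
apply: le_trans (ler_norm_sum _ _ _) _.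
rewrite -[leRHS]mulr1 -psi1 mulr_sumr; apply: ler_sum => i _.
rewrite normrM (ger0_norm (psi0 _ _)).
have [->|/psid ax] := eqVneq (psi i x) 0; first by rewrite !mulr0.
by rewrite ler_wpM2r// distrC phie.
Qed.

End partition_of_unity.

Section weak_convergence.
Context {R : realType} {X : pointedMetricType R}.
Hypothesis compactX : compact [set: X].
Implicit Types (mu nu : probability (borel X) R) (phi : X -> R).

(** Open sets are stable under intersection and generate the Borel sets, and the indicator of an
    open set is a bounded pointwise limit of continuous functions. *)
Lemma same_measure_continuous mu nu :
  (forall phi, continuous phi -> \int[mu]_x phi x = \int[nu]_x phi x) ->
  same_measure mu nu.
Proof.
move=> munu.
have npos (j : nat) : 0 < j.+1%:R^-1 :> R by rewrite invr_gt0.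
have [n nP] := choice (fun j => partition_of_unity compactX _ (npos j)).
have [a aP] := choice nP; have [psi psiP] := choice aP.
suff openE (W : set X) : open W -> mu W = nu W.
  move=> A mA; apply: (@measure_unique _ _ (borel X) (@open X) (fun=> setT)) => //.
  - by move=> B C; exact: openI.
  - by move=> _; exact: openT.
  - by apply/seteqP; split => // x _; exists 0%N.
  - by move=> k; rewrite (le_lt_trans (probability_le1 mu _))// ltry.
move=> oW.
(* The sum of the bumps whose support is guaranteed to lie in [W] tends to the
   indicator of [W]. *)
pose inW j i : bool := `[< ball (a j i) j.+1%:R^-1 `<=` W >].
pose h j x := \sum_(i < n j) (inW j i)%:R * psi j i x.
have ch j : continuous (h j).
  apply: (@continuous_sum _ _ 'I_(n j) _ (fun i x => (inW j i)%:R * psi j i x)) => i.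
  by apply: continuous_scale; have [H _ _ _] := psiP j.
have h_cvg (la : probability (borel X) R) :
    \int[la]_x h j x @[j --> \oo] --> \int[la]_x (\1_W x : R).
  apply: (@bounded_convergence _ _ la h (\1_W : X -> R) 1).
  - by move=> j; exact: continuous_measurable.
  - by apply: measurable_indic; exact: open_borel.
  - move=> j x; have [_ p0 p1 _] := psiP j.
    rewrite ger0_norm ?sumr_ge0// => [|i _]; last by rewrite mulr_ge0.
    by rewrite -(p1 x) ler_sum// => i _; rewrite ler_piMl// lern1 leq_b1.
  - apply: aeW => x; rewrite indicE; have [xW|xW] := pselect (W x); last first.
      rewrite memNset//; apply: cvg_near_cst; apply: nearW => j.
      rewrite /h big1// => i _; have [_ _ _ pd] := psiP j.
      have [->|/pd ax] := eqVneq (psi j i x) 0; first by rewrite mulr0.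
      by rewrite /inW asboolF ?mul0r// => /(_ x); rewrite ballEmdist /= => /(_ ax).
    rewrite mem_set//; apply: cvg_near_cst.
    have /nbhs_ballP[r /= r0 rW] := open_nbhs_nbhs (conj oW xW).
    exists (Num.truncn (2 / r)) => // j /= rj; have [_ _ p1 pd] := psiP j.
    have jr : 2 * j.+1%:R^-1 <= r.
      rewrite ler_pdivrMr// mulrC -ler_pdivrMr// ltW//.
      by apply: lt_le_trans (truncnS_gt _) _; rewrite ler_nat.
    rewrite -(p1 x) /h; apply: eq_bigr => i _.
    have [->|/pd ax] := eqVneq (psi j i x) 0; first by rewrite mulr0.
    rewrite /inW asboolT ?mul1r// => y; rewrite ballEmdist /= => ay; apply: rW.
    rewrite ballEmdist /=; apply: le_lt_trans (metric_triangle _ (a j i) _) _.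
    by rewrite (metric_sym x); move: (j.+1%:R^-1) jr ax ay => q jr ax ay; lra.
have WE (la : probability (borel X) R) : la W = (\int[la]_x (\1_W x : R))%:E.
  rewrite /Rintegral integral_indic ?setIT//; last exact: open_borel.
  by rewrite fineK// fin_num_measure//; exact: open_borel.
rewrite !WE; congr EFin.
have nu_cvg := h_cvg nu.
have E : (fun j => \int[nu]_x h j x) = (fun j => \int[mu]_x h j x).
  by apply/funext => j; rewrite munu.
by rewrite E in nu_cvg; exact: (@cvg_unique _ (@Rhausdorff R) _ _ _ _ (h_cvg mu) nu_cvg).
Qed.

End weak_convergence.

Section generic_points.
Context {R : realType} {X : pointedMetricType R}.
Variable f : X -> X.
Hypotheses (compactX : compact [set: X]) (cont_f : continuous f).
Implicit Types (mu nu : probability (borel X) R) (phi : X -> R).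

Lemma birkhoff_convergesD phi psi y (A B : R) :
  birkhoff_converges f phi y A -> birkhoff_converges f psi y B ->
  birkhoff_converges f (fun x => phi x + psi x) y (A + B).
Proof.
move=> HA HB e e0; have e2 : 0 < e / 2 by rewrite divr_gt0.
have [N NP] := HA _ e2; have [K KP] := HB _ e2.
exists (maxn N K) => n; rewrite geq_max => /andP[/NP h1 /KP h2].
rewrite /birkhoff_sum big_split /= -/(birkhoff_sum f phi n y) -/(birkhoff_sum f psi n y).
move/ler_normlP : h1 => [a1 a2]; move/ler_normlP : h2 => [b1 b2].
by apply/ler_normlP; split; lra.
Qed.

Lemma birkhoff_convergesZ phi y (c A : R) :
  birkhoff_converges f phi y A -> birkhoff_converges f (fun x => c * phi x) y (c * A).
Proof.
move=> HA e e0; have c0 : 0 < `|c| + 1 by rewrite ltr_wpDl.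
have [N NP] := HA _ (divr_gt0 e0 c0); exists N => n /NP.
rewrite /birkhoff_sum -mulr_sumr -/(birkhoff_sum f phi n y) -mulrA -mulrBr normrM => h.
apply: le_trans (ler_wpM2l (normr_ge0 c) h) _; rewrite mulrA ler_wpM2r//.
by rewrite mulrA ler_pdivrMr// mulrC ler_wpM2l ?(ltW e0)// lerDl.
Qed.

Lemma birkhoff_converges_approx phi psi y (A B e : R) :
  (forall x, `|phi x - psi x| <= e) -> `|A - B| <= e ->
  birkhoff_converges f psi y B -> forall e', 0 < e' -> exists N, forall n, (N <= n)%N ->
    `|birkhoff_sum f phi n y - A * n%:R| <= (e + e + e') * n%:R.
Proof.
move=> phipsi AB HB e' e'0; have [N NP] := HB _ e'0; exists N => n /NP h.
have : `|birkhoff_sum f (fun x => phi x - psi x) n y| <= e * n%:R.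
  exact: norm_birkhoff_sum_le.
rewrite /birkhoff_sum sumrB -/(birkhoff_sum f phi n y) -/(birkhoff_sum f psi n y).
have {AB} : `|(A - B) * n%:R| <= e * n%:R.
  by rewrite normrM (ger0_norm (ler0n _ _)) ler_wpM2r.
move/ler_normlP : h => [h1 h2] /ler_normlP[a1 a2] /ler_normlP[b1 b2].
by apply/ler_normlP; split; lra.
Qed.

(** [phi] is within [e] of the combination of the [psi i] with coefficients [phi (a i)]. One [e] is
    lost in the sum, one in the integral and one in the convergence. *)
Lemma ergodic_partition_approx mu phi (y : X) (n : nat) (a : nat -> X)
    (psi : nat -> X -> R) (d e : R) :
  continuous phi -> 0 < e ->
  (forall x z, mdist x z < d -> `|phi x - phi z| <= e) ->
  (forall i, continuous (psi i)) -> (forall i x, 0 <= psi i x) ->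
  (forall x, \sum_(i < n) psi i x = 1) ->
  (forall i x, psi i x != 0 -> mdist (a i) x < d) ->
  (forall i, birkhoff_converges f (psi i) y (\int[mu]_x psi i x)) ->
  exists N, forall k, (N <= k)%N ->
    `|birkhoff_sum f phi k y - (\int[mu]_x phi x) * k%:R| <= (e + e + e) * k%:R.
Proof.
move=> cphi e0 phid cpsi p0 p1 pd py.
have int_c h : continuous h -> mu.-integrable setT (EFin \o (h : borel X -> R)).
  move=> ch; apply: bounded_measurable_integrable.
  exact: continuous_bounded_measurable.
pose phi' k x := \sum_(i < k) phi (a i) * psi i x.
have cphi' k : continuous (phi' k).
  apply: (@continuous_sum _ _ 'I_k _ (fun i x => phi (a i) * psi i x)) => i.
  exact: continuous_scale.
have good k : birkhoff_converges f (phi' k) y (\int[mu]_x phi' k x).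
  elim: k => [|k IH].
    have -> : phi' 0%N = (fun=> 0) by apply/funext => x; rewrite /phi' big_ord0.
    rewrite Rintegral_prob_cst => e' e'0; exists 0%N => m _.
    by rewrite /birkhoff_sum big1// mul0r subrr normr0 mulr_ge0// ltW.
  have -> : phi' k.+1 = (fun x => phi' k x + phi (a k) * psi k x).
    by apply/funext => x; rewrite /phi' big_ord_recr.
  rewrite RintegralD//; first 1 last.
  - exact: int_c.
  - by apply: int_c; exact: continuous_scale.
  rewrite RintegralZl//; last exact: int_c.
  by apply: birkhoff_convergesD => //; exact: birkhoff_convergesZ.
have close x : `|phi x - phi' n x| <= e 
  by exact: (partition_of_unity_approx phi d).
apply: (birkhoff_converges_approx phi (phi' n) y _ _ e close _ (good n) e e0).
rewrite -RintegralB//; [|exact: int_c|exact: int_c].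
have cB : continuous (fun z => phi z - phi' n z).
  by move=> x; apply: cvgB; [exact: cphi|exact: cphi'].
apply: le_trans; first by apply: le_normr_Rintegral => //; exact: int_c.
rewrite -[leRHS](Rintegral_prob_cst mu).
apply: le_Rintegral => //.
- by apply: int_c => x; apply: cvg_norm; exact: cB.
- by apply: bounded_measurable_integrable; exact: bounded_measurable_cst.
Qed.

(** The bumps of all the partitions are countably many, so almost every point has convergent
    averages for all of them at once. *)
Lemma exists_generic mu : ergodic_measure f mu ->
  exists y, forall phi, continuous phi -> birkhoff_converges f phi y (\int[mu]_x phi x).
Proof.
move=> erg.
have npos (j : nat) : 0 < j.+1%:R^-1 :> R by rewrite invr_gt0.
have [n nP] := choice (fun j => partition_of_unity compactX _ (npos j)).
have [a aP] := choice nP; have [psi psiP] := choice aP.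
have cpsi j i : continuous (psi j i) by have [H _ _ _] := psiP j.
have mu0 : (0 < mu setT)%E by have := @probability_setT _ _ _ mu => ->.
have [y yP] := @filter_ex _ _ (ae_properfilter_algebraOfSetsType mu0) _
  (ae_foralln (fun j => ae_foralln (fun i =>
    ergodic_birkhoff f compactX cont_f mu (psi j i) erg (cpsi j i)))).
exists y => phi cphi e e0.
have e3 : 0 < e / 3 by rewrite divr_gt0.
have [d d0 phid] := uniform_continuity compactX phi _ cphi e3.
set j := Num.truncn d^-1.
have jd : j.+1%:R^-1 <= d.
  by rewrite -[leRHS]invrK lef_pV2 ?posrE ?invr_gt0// ltW// truncnS_gt.
have [_ p0 p1 pd] := psiP j.
have -> : e = e / 3 + e / 3 + e / 3 by field.
apply: (ergodic_partition_approx mu phi y (n j) (a j) (psi j) _ _ cphi e3 _ (cpsi j)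
  p0 p1 pd (yP j)).
move=> x z xz; have := phid x z (ltW (lt_le_trans xz jd)).
by rewrite /ball /= => /ltW.
Qed.

End generic_points.

Section separation.
Context {R : realType} {X : pointedMetricType R}.
Variable f : X -> X.
Hypotheses (compactX : compact [set: X]) (cont_f : continuous f).
Implicit Types (mu nu : probability (borel X) R) (phi : X -> R).

Lemma birkhoff_average_cvg phi y (A : R) : birkhoff_converges f phi y A ->
  birkhoff_sum f phi n.+1 y / n.+1%:R @[n --> \oo] --> A.
Proof.
move=> H; apply/cvgrPdist_le => e e0; have [N NP] := H e e0.
exists N => // n /= Nn; have := NP n.+1 (leqW Nn).
have n0 : 0 < n.+1%:R :> R by [].
have -> : A - birkhoff_sum f phi n.+1 y / n.+1%:R =
    - (birkhoff_sum f phi n.+1 y - A * n.+1%:R) / n.+1%:R.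
  by field; rewrite nat1r gt_eqF.
by rewrite normrM normrN normfV (gtr0_norm n0) ler_pdivrMr.
Qed.

Lemma Rintegral_sum mu (I : Type) (s : seq I) (h : I -> X -> R) :
  (forall i, mu.-integrable setT (EFin \o (h i : borel X -> R))) ->
  \int[mu]_x (\sum_(i <- s) h i x) = \sum_(i <- s) \int[mu]_x h i x.
Proof.
move=> ih; elim: s => [|i s IH].
  by under eq_Rintegral do rewrite big_nil; rewrite big_nil Rintegral_prob_cst.
under eq_Rintegral do rewrite big_cons.
rewrite big_cons -IH RintegralD//.
rewrite (_ : _ \o _ = fun x => (\sum_(i <- s) (h i x)%:E)%E).
  by apply: integrable_sum => // j _; exact: ih.
by apply/funext => x; rewrite /= sumEFin.
Qed.

(* The Birkhoff averages of [phi] tend to distinct constants for [mu] and [nu]; [g]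
   is a bump around the first constant, applied to a long average. *)
Lemma ergodic_separation mu nu (e : R) : ergodic_measure f mu -> ergodic_measure f nu ->
  ~ same_measure mu nu -> 0 < e ->
  exists g : X -> R, [/\ continuous g, forall x, 0 <= g x,
    2^-1 <= \int[mu]_x g x & \int[nu]_x g x <= e].
Proof.
move=> emu enu munu e0.
have [phi cphi phiAB] : exists2 phi : X -> R, continuous phi &
    \int[mu]_x phi x <> \int[nu]_x phi x.
  apply: contrapT => H; apply: munu; apply: same_measure_continuous => // phi cphi.
  by apply: contrapT => ne; apply: H; exists phi.
set A := \int[mu]_x phi x in phiAB; set B := \int[nu]_x phi x in phiAB.
(* With half-width [d] the tent about [A] vanishes at [B]. *)
pose d := `|B - A| / 2.
have d0 : 0 < d by rewrite divr_gt0// normr_gt0 subr_eq0; apply/eqP => /esym.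
pose bump (r : R) := Num.max 0 (1 - `|r - A| / d).
have cbump : continuous bump.
  apply: continuous_max0; apply: continuous_add; first by move=> r; exact: cvg_cst.
  move=> r; apply: cvgN; apply: cvgMl; apply: cvg_norm.
  by apply: cvgB; [exact: cvg_id|exact: cvg_cst].
have bump_le1 r : `|bump r| <= 1.
  rewrite ger0_norm ?le_max ?lexx// ge_max ler01 /= gerBl divr_ge0// ltW//.
pose g (n : nat) x := bump (birkhoff_sum f phi n.+1 x / n.+1%:R).
have cg n : continuous (g n).
  move=> x; apply: (@continuous_comp _ _ _
    (fun x => birkhoff_sum f phi n.+1 x / n.+1%:R) bump).
    by apply: cvgMl; exact: (continuous_birkhoff_sum f cont_f).
  exact: cbump.
have g_cvg (la : probability (borel X) R) : ergodic_measure f la ->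
    \int[la]_x g n x @[n --> \oo] --> bump (\int[la]_x phi x).
  move=> ela; rewrite -[X in _ --> X](Rintegral_prob_cst la).
  apply: (@bounded_convergence _ _ la g (fun=> bump (\int[la]_x phi x)) 1) => //.
  - by move=> n; exact: continuous_measurable.
  - by move=> n x; exact: bump_le1.
  have FF := ae_filter_ringOfSetsType la.
  apply: (@filterS _ _ FF _ _ _ (ergodic_birkhoff f compactX cont_f la phi ela cphi)).
  by move=> x /birkhoff_average_cvg H; apply: continuous_cvg H; exact: cbump.
have bA : bump A = 1 by rewrite /bump subrr normr0 mul0r subr0 max_r.
have bB : bump B = 0.
  rewrite /bump -/B; have -> : `|B - A| = d * 2 by rewrite /d divfK.
  by rewrite mulrAC divff ?gt_eqF// mul1r max_l// subr_le0 ler1n.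
have mu1 := g_cvg mu emu; rewrite -/A bA in mu1.
have nu0 := g_cvg nu enu; rewrite -/B bB in nu0.
have half : 0 < 2^-1 :> R by rewrite invr_gt0.
move/cvgrPdist_le : mu1 => /(_ _ half) [N1 _ N1P].
move/cvgrPdist_le : nu0 => /(_ _ e0) [N2 _ N2P].
exists (g (maxn N1 N2)); split => //.
- by move=> x; rewrite /g /bump le_max lexx.
- have := N1P (maxn N1 N2) (leq_maxl _ _); rewrite ler_norml => /andP[_] /=.
  by rewrite lerBlDr -lerBlDl; apply: le_trans; lra.
- have := N2P (maxn N1 N2) (leq_maxr _ _); rewrite ler_norml => /andP[] /=.
  by rewrite sub0r lerN2.
Qed.

(** Adding nonnegative functions keeps each lower bound, while the integrals against [nu] add up.
    The divisor [m.+1] also covers [m = 0]. *)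
Lemma ergodic_separation_family m (mu : 'I_m -> probability (borel X) R) nu (e : R) :
  (forall i, ergodic_measure f (mu i)) -> ergodic_measure f nu ->
  (forall i, ~ same_measure (mu i) nu) -> 0 < e ->
  exists g : X -> R, [/\ continuous g, forall x, 0 <= g x,
    forall i, 2^-1 <= \int[mu i]_x g x & \int[nu]_x g x <= e].
Proof.
move=> emu enu munu e0.
have em : 0 < e / m.+1%:R by rewrite divr_gt0.
have [g gP] := choice (fun i => ergodic_separation _ _ _ (emu i) enu (munu i) em).
pose h x := \sum_(i < m) g i x.
have int_c (la : probability (borel X) R) k : continuous k ->
    la.-integrable setT (EFin \o (k : borel X -> R)).
  move=> ck; apply: bounded_measurable_integrable.
  exact: continuous_bounded_measurable.
have cg i : continuous (g i) by have [] := gP i.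
have g0 i x : 0 <= g i x by have [] := gP i.
have ch : continuous h by exact: (@continuous_sum _ _ 'I_m _ g).
exists h; split => //.
- by move=> x; rewrite sumr_ge0.
- move=> i; have [_ _ + _] := gP i; move/le_trans; apply.
  apply: le_Rintegral => //; [exact: int_c|exact: int_c|move=> x _].
  by rewrite /h (bigD1 i)//= lerDl sumr_ge0.
- rewrite /h Rintegral_sum; last by move=> i; exact: int_c.
  apply: (@le_trans _ _ (\sum_(i < m) e / m.+1%:R)).
    by apply: ler_sum => i _; have [] := gP i.
  rewrite sumr_const card_ord -[_ *+ m]mulr_natr mulrAC ler_pdivrMr// ler_wpM2l ?(ltW e0)//.
  by rewrite ler_nat.
Qed.

End separation.

(** * Accumulation points of empirical measures *)

Section empirical_measures.
Context {R : realType} {X : pointedMetricType R}.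
Variable f : X -> X.
Hypothesis compactX : compact [set: X].
Implicit Types (mu nu : probability (borel X) R) (phi : X -> R).

Lemma Rintegral_empirical phi x n : continuous phi ->
  \int[empirical f x n]_y phi y = birkhoff_sum f phi n.+1 x / n.+1%:R.
Proof.
move=> cphi; have [B B0 phiB] := continuous_bounded compactX phi cphi.
(* Integrals against a sum of measures split for nonnegative functions; the general case follows by
   applying this to [phi + B]. *)
have nonneg (h : X -> R) : continuous h -> (forall y, 0 <= h y) ->
    \int[empirical f x n]_y h y = birkhoff_sum f h n.+1 x / n.+1%:R.
  move=> ch h0.
  have mh : measurable_fun [set: borel X] (fun y : borel X => (h y)%:E).
    by apply/measurable_EFinP; exact: continuous_measurable.
  have h0' (y : borel X) : setT y -> (0 <= (h y)%:E)%E by rewrite lee_fin.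
  rewrite /Rintegral /empirical ge0_integral_mscale// ge0_integral_measure_sum//.
  under eq_bigr do rewrite integral_dirac// diracT mul1e.
  by rewrite sumEFin /= mulrC.
have cB : continuous (fun y => phi y + B).
  by apply: continuous_add => // y; exact: cvg_cst.
have := nonneg _ cB; rewrite RintegralD//; first last.
- by apply: bounded_measurable_integrable; exact: bounded_measurable_cst.
- by apply: bounded_measurable_integrable; exact: continuous_bounded_measurable.
rewrite Rintegral_prob_cst /birkhoff_sum big_split /= sumr_const card_ord.
rewrite -[_ *+ n.+1]mulr_natr mulrDl mulfK ?pnatr_eq0// => H.
apply: (addIr B); apply: H => y.
by have := phiB y; rewrite ler_norml => /andP[]; lra.
Qed.

(** The weak* topology is initial for [integral_map] into a pointwise topology, so convergence can
    be tested on one continuous function at a time. *)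
Lemma Vf_subsequence x mu (l : nat -> nat) :
  (forall N, exists K, forall k, (K <= k)%N -> (N <= l k)%N) ->
  (forall phi, continuous phi ->
    birkhoff_sum f phi (l k).+1 x / (l k).+1%:R @[k --> \oo] --> \int[mu]_y phi y) ->
  Vf f x mu.
Proof.
move=> linf cphi A B [N _ NA] muB.
have [_ [[[V oV <-] Vmu] VB]] : exists W : set (weak_star X), (open W /\ W mu) /\ W `<=` B.
  by move: muB; rewrite nbhsE => -[W [oW Wmu] WB]; exists W.
pose F := (integral_map \o (fun k => (empirical f x (l k) : probability (borel X) R))).
have Fmu : F @ \oo --> (integral_map mu : {ptws continuousType X R -> R}).
  apply/cvg_sup => phi W; rewrite nbhsE => -[_ [[V' oV' <-] V'mu] V'W].
  have cphi' : continuous phi := @cts_fun _ _ phi.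
  have [K _ KV] := cphi phi cphi' V' (open_nbhs_nbhs (conj oV' V'mu)).
  exists K => // k Kk; apply: V'W; have := KV k Kk.
  by rewrite /= /F /= /integral_map Rintegral_empirical.
have [K _ KV] := Fmu V (open_nbhs_nbhs (conj oV Vmu)).
have [K' K'N] := linf N.
exists ((empirical f x (l (maxn K K')) : probability (borel X) R) : weak_star X); split.
  by apply: NA; apply: K'N; exact: leq_maxr.
by apply: VB; apply: KV; exact: leq_maxl.
Qed.

(** The measures with integral of [g] below [c] form a weak* neighbourhood of [nu] that the
    empirical measures eventually avoid. *)
Lemma not_Vf x nu (g : X -> R) (c : R) N : continuous g ->
  \int[nu]_y g y < c ->
  (forall n, (N <= n)%N -> c * n%:R <= birkhoff_sum f g n x) -> ~ Vf f x nu.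
Proof.
move=> cg nug gN.
pose phi : continuousType X R := mkcts cg.
have nbh : nbhs (nu : weak_star X) [set la : weak_star X | integral_map la phi < c].
  apply: (@initial_continuous _ _ (@integral_map R X) nu
    [set F : {ptws continuousType X R -> R} | F phi < c]).
  apply: (@proj_continuous _ (fun=> R) phi (integral_map nu) [set r | r < c]).
  by apply: open_nbhs_nbhs; split; [exact: open_lt|exact: nug].
have far : ((fun n => (empirical f x n : probability (borel X) R) : weak_star X) @ \oo)
    [set la : weak_star X | c <= integral_map la phi].
  exists N => // n /= Nn; rewrite /integral_map Rintegral_empirical//.
  by rewrite ler_pdivlMr ?ltr0n// gN// leqW.
by move=> /(_ _ _ far nbh)[la [/= h1]]; rewrite ltNge h1.
Qed.

End empirical_measures.

(** * The scrambled set *)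

(** Cantor's diagonal argument: [D] would differ from itself at its own code. *)
Lemma uncountable_range {T : choiceType} (z : (nat -> bool) -> T) :
  injective z -> ~ countable (range z).
Proof.
move=> zinj /countable_injP[h hinj].
have hz_inj a b : h (z a) = h (z b) -> a = b.
  by move=> hab; apply: zinj; apply: hinj hab; apply/mem_set; [exists a|exists b].
pose D n : bool := `[< exists2 a, h (z a) = n & a n = false >].
case DE : (D (h (z D))).
  by have /asboolP[a /hz_inj ->] := DE; rewrite DE.
by move/negP: (negbT DE); apply; apply/asboolP; exists D.
Qed.

Section distributional_chaos.
Context {R : realType} {X : pointedMetricType R}.
Variable f : X -> X.

Lemma card_ord_lt (s l : nat) : (#|[pred j : 'I_l | (j < s)%N]| <= s)%N.
Proof.
have [sl|ls] := leqP s l.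
  rewrite -sum1_card (eq_bigl (fun j : 'I_l => (j < s)%N))//.
  by rewrite -(big_ord_widen l (fun=> 1%N) sl) big_const_ord iter_addn_0 mul1n.
by rewrite (leq_trans (max_card _))// card_ord ltnW.
Qed.

(** At time [l k.+1] block [k] fills all but a fraction below [1/(k+1)] of the past, so its
    behaviour alone decides the frequency there. *)
Lemma DC1_pair_blocks (x y : X) (s l : nat -> nat) (t0 : R) :
  (forall k, k.+1 * s k < l k.+1)%N -> (forall k, (k <= l k)%N) ->
  (forall t, 0 < t -> forall N, exists2 k, (N <= k)%N & forall n,
    (s k <= n < l k.+1)%N -> mdist (iter n f x) (iter n f y) < t) ->
  0 < t0 ->
  (forall N, exists2 k, (N <= k)%N & forall n,
    (s k <= n < l k.+1)%N -> t0 <= mdist (iter n f x) (iter n f y)) ->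
  DC1_pair f x y.
Proof.
move=> sl kl close t00 far.
have ratio (e : R) k : 0 < e -> (Num.truncn e^-1 <= k)%N -> (s k)%:R / (l k.+1)%:R <= e.
  move=> e0 ek; have l0 : (0 < l k.+1)%N by exact: leq_trans (kl _).
  rewrite ler_pdivrMr ?ltr0n//.
  have : (k.+1 * s k)%:R <= (l k.+1)%:R :> R by rewrite ler_nat ltnW.
  rewrite natrM => h; rewrite -ler_pdivrMl//; apply: le_trans h.
  rewrite ler_wpM2r// ltW//; apply: lt_le_trans (truncnS_gt _) _.
  by rewrite ler_nat.
split=> [t t_gt0|].
  apply/eqP; rewrite eq_le; apply/andP; split.
    apply: (@limn_esup_le _ _ _ 0%N) => -[|n] _; rewrite lee_fin.
      (* At [n = 0] the frequency is [0], because [0^-1 = 0]. *)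
      by rewrite invr0 mulr0 ler01.
    by rewrite ler_pdivrMr ?ltr0n// mul1r ler_nat (leq_trans (max_card _))// card_ord.
  apply/lee_subgt0Pr => e e0; apply: limn_esup_ge => N.
  have [k Nk kt] := close t t_gt0 (maxn N (Num.truncn e^-1)).
  move: Nk; rewrite geq_max => /andP[Nk ek].
  exists (l k.+1); first by rewrite (leq_trans Nk)// (leq_trans (leqnSn _) (kl _)).
  rewrite -EFinB lee_fin lerBlDr; have l0 : (0 < l k.+1)%N by exact: leq_trans (kl _).
  apply: le_trans (lerD (lexx _) (ratio e k e0 ek)).
  rewrite -mulrDl -natrD ler_pdivlMr ?ltr0n// mul1r ler_nat.
  rewrite -[leqLHS]card_ord -(cardC [pred j : 'I_(l k.+1) |
    mdist (iter j f x) (iter j f y) < t]) leq_add2l.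
  apply: leq_trans (card_ord_lt (s k) (l k.+1)); apply: subset_leq_card.
  apply/fintype.subsetP => j; rewrite !inE; apply: contraR; rewrite -leqNgt => sj.
  by rewrite kt// sj /=.
exists t0 => //; apply/eqP; rewrite eq_le; apply/andP; split; last first.
  by apply: (@limn_einf_ge _ _ _ 0%N) => n _; rewrite lee_fin divr_ge0.
apply/lee_addgt0Pr => e e0; rewrite add0e; apply: limn_einf_le => N.
have [k Nk kt] := far (maxn N (Num.truncn e^-1)).
move: Nk; rewrite geq_max => /andP[Nk ek].
exists (l k.+1); first by rewrite (leq_trans Nk)// (leq_trans (leqnSn _) (kl _)).
rewrite lee_fin; apply: le_trans (ratio e k e0 ek).
rewrite ler_wpM2r ?invr_ge0// ler_nat.
apply: leq_trans (card_ord_lt (s k) (l k.+1)); apply: subset_leq_card.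
apply/fintype.subsetP => j; rewrite !inE; apply: contraLR; rewrite -leqNgt -leNgt => sj.
by rewrite kt// sj /=.
Qed.

End distributional_chaos.

Section transitive_points.
Context {R : realType} {X : pointedMetricType R}.

Lemma dense_visits_Trans (f : X -> X) (z : X) :
  (forall x (r : R) N, 0 < r -> exists2 n, (N <= n)%N & mdist x (iter n f z) < r) ->
  Trans f z.
Proof.
move=> visits; apply/seteqP; split => // x _ A B [N _ NA] /nbhs_ballP[r /= r0 rB].
have [n Nn xn] := visits x r N r0; exists (iter n f z); split; first exact: NA.
by apply: rB; rewrite ballEmdist.
Qed.

End transitive_points.

Section itineraries.
Context {R : realType} {X : pointedMetricType R}.
Variables (f : X -> X) (e0 : R) (s l : nat -> nat).
Hypothesis compactX : compact [set: X].
Hypotheses (ls : forall k, (l k <= s k)%N).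
Hypotheses (l_gt0 : forall k, (0 < l k)%N) (sl : forall k, (k.+1 * s k < l k.+1)%N).

Lemma shadowed_generic_Vf (mu : probability (borel X) R) (g z : X) (y : nat -> X) :
  (forall phi, continuous phi -> birkhoff_converges f phi g (\int[mu]_x phi x)) ->
  shadows f e0 s l y z -> (forall N, exists2 k, (N <= k)%N & y k = g) ->
  Vf f z mu.
Proof.
move=> gen yz often.
have [h hP] := choice (fun N => (exists2P _ _).1 (often N)).
(* Sampling at the ends of the blocks that follow [g]; the predecessor compensates for [empirical]
   of index [n] averaging [n + 1] points. *)
apply: (Vf_subsequence f compactX z mu (fun k => (l (h k).+1).-1)) => [N|phi cphi].
  exists N => k Nk; have [kh _] := hP k.
  by have := block_lengths_ge s l l_gt0 ls sl (h k).+1; lia.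
apply/cvgrPdist_le => e e_gt0.
have [K KP] := birkhoff_sum_block_end f compactX e0 s l l_gt0 ls sl
  phi _ g cphi (gen phi cphi) e e_gt0.
exists K => // k /= Kk; have [kh yk] := hP k.
have := KP y z yz (h k) (leq_trans Kk kh) yk.
rewrite prednK//; set L := l (h k).+1; set A := \int[mu]_x phi x.
have L0 : 0 < L%:R :> R by rewrite ltr0n /L.
have -> : A - birkhoff_sum f phi L z / L%:R = - (birkhoff_sum f phi L z - A * L%:R) / L%:R.
  by field; rewrite gt_eqF.
by rewrite normrM normrN normfV (gtr0_norm L0) ler_pdivrMr.
Qed.

Lemma shadowed_close (y y' : nat -> X) (z z' g : X) :
  shadows f e0 s l y z -> shadows f e0 s l y' z' ->
  (forall N, exists2 k, (N <= k)%N & y k = g /\ y' k = g) ->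
  forall t : R, 0 < t -> forall N, exists2 k, (N <= k)%N & forall n,
    (s k <= n < l k.+1)%N -> mdist (iter n f z) (iter n f z') < t.
Proof.
move=> yz yz' often t t0 N.
have [K KP] := shadow_radius e0 _ (divr_gt0 t0 (ltr0n R 3)).
have [k] := often (maxn N K); rewrite geq_max => /andP[Nk Kk] [yk yk'].
exists k => // n nk; have := KP k Kk; have := yz k n nk; have := yz' k n nk.
rewrite yk yk' => h1 h2 h3.
apply: le_lt_trans (metric_triangle _ (iter (n - s k) f g) _) _.
by rewrite (metric_sym (iter n f z)); lra.
Qed.

Lemma shadowed_far (y y' : nat -> X) (z z' a b : X) (t : R) :
  shadows f e0 s l y z -> shadows f e0 s l y' z' ->
  (forall N, exists2 k, (N <= k)%N & y k = a /\ y' k = b) ->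
  0 < t -> (forall n, t <= mdist (iter n f a) (iter n f b)) ->
  forall N, exists2 k, (N <= k)%N & forall n,
    (s k <= n < l k.+1)%N -> t / 2 <= mdist (iter n f z) (iter n f z').
Proof.
move=> yz yz' often t0 ab N.
have [K KP] := shadow_radius e0 _ (divr_gt0 t0 (ltr0n R 4)).
have [k] := often (maxn N K); rewrite geq_max => /andP[Nk Kk] [yk yk'].
exists k => // n nk; have := KP k Kk; have := yz k n nk; have := yz' k n nk.
rewrite yk yk' => h1 h2 h3; have := ab (n - s k)%N.
have := metric_triangle (iter (n - s k) f a) (iter n f z) (iter (n - s k) f b).
have := metric_triangle (iter n f z) (iter n f z') (iter (n - s k) f b).
by rewrite (metric_sym (iter n f z') (iter (n - s k) f b)); lra.
Qed.

End itineraries.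

Lemma birkhoff_converges_lower_bound {R : realType} {X : pointedMetricType R}
    (f : X -> X) (g : X -> R) (y : X) (A c : R) :
  birkhoff_converges f g y A -> c < A ->
  exists N, forall n, (N <= n)%N -> c * n%:R <= birkhoff_sum f g n y.
Proof.
move=> conv cA; have [N NP] := conv (A - c) ltac:(by rewrite subr_gt0).
by exists N => n /NP; rewrite ler_norml => /andP[]; lra.
Qed.

Theorem theorem4p2 (R : realType) (X : pointedMetricType R) (f : X -> X)
    (compactX : compact [set: X])
    (two_points : exists x y : X, x <> y)
    (cont_f : continuous f)
    (tau : \bar R) (tau_ge0 : (0 <= tau)%E)
    (spec_f : nonuniform_tau_specification f tau)
    (tau_fin : (tau < +oo)%E)
    (m n : nat) (m_gt0 : (0 < m)%N) (n_gt0 : (0 < n)%N)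
    (mu : 'I_m -> probability (borel X) R)
    (nu : 'I_n -> probability (borel X) R)
    (erg_mu : forall i, ergodic_measure f (mu i))
    (erg_nu : forall j, ergodic_measure f (nu j))
    (distinct_mu : forall i i', i <> i' -> ~ same_measure (mu i) (mu i'))
    (distinct_nu : forall j j', j <> j' -> ~ same_measure (nu j) (nu j'))
    (distinct_mu_nu : forall i j, ~ same_measure (mu i) (nu j))
    (U : set X) (open_U : open U) (U_neq0 : U !=set0) :
  exists S : set X,
    [/\ ~ countable S,
        DC1_scrambled f S
      & S `<=` (\bigcap_i \bigcap_j (Gmu f (mu i) `\` Gmu f (nu j)))
               `&` U `&` Trans f].
Proof.
have [[M specM tauM] _] := spec_f.
have [T good] : exists T : nat, forall e : R, 0 < e -> forall N,
    exists2 k, (N <= k)%N & (M k e <= T * k)%N.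
  by apply: linear_gaps; rewrite tauM.
set C : R := (1 + 2 * T)%:R.
have C0 : 0 < C by rewrite ltr0n.
(* All rates are fixed by [T] before [g] is chosen: [c0 < 1/2] for the generic points, [c1] for the
   pair from [distal_pair], [c2] for the final orbits. The integrals against [nu j] can then be made
   at most [c2 / 2]. *)
pose c0 : R := 4^-1.
have c0_gt0 : 0 < c0 by rewrite invr_gt0.
pose c1 := c0 / (4 * C); pose c2 := c1 / (8 * C).
have c1_gt0 : 0 < c1 by rewrite divr_gt0// mulr_gt0.
have c2_gt0 : 0 < c2 by rewrite divr_gt0// mulr_gt0.
have c10 : c1 <= c0.
  have C1 : 1 <= C by rewrite ler1n.
  by rewrite ler_pdivrMr ?mulr_gt0//; move: C1 c0_gt0; clear; nra.
have c2_half : 0 < c2 / 2 by rewrite divr_gt0.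
have [g gP] := choice (fun j => ergodic_separation_family f compactX cont_f m mu
  (nu j) (c2 / 2) erg_mu (erg_nu j) (fun i => distinct_mu_nu i j) c2_half).
have cg j : continuous (g j) by have [] := gP j.
have g0 j x : 0 <= g j x by have [] := gP j.
have [gen genP] := choice (fun i => exists_generic f compactX cont_f (mu i) (erg_mu i)).
have gen_c0 i j : exists N, forall k, (N <= k)%N ->
    c0 * k%:R <= birkhoff_sum f (g j) k (gen i).
  apply: (birkhoff_converges_lower_bound f (g j) (gen i) _ c0 (genP i (g j) (cg j))).
  have [_ _ + _] := gP j; move=> /(_ i); apply: lt_le_trans.
  by rewrite /c0 ltf_pV2 ?posrE// ltr_nat.
have [p [q pq]] := two_points.
pose i0 : 'I_m := Ordinal m_gt0.
have [w [t [t0 wt wc]]] := distal_pair f M compactX cont_f specM T n g c0 (gen i0) p q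
  good pq cg g0 c0_gt0 (gen_c0 i0).
have [u Uu] := U_neq0.
have [r /= r0 rU] : exists2 r : R, 0 < r & ball u r `<=` U.
  by apply/nbhs_ballP; exact: open_nbhs_nbhs.
pose e0 := r / 2; have e0_gt0 : 0 < e0 by rewrite divr_gt0.
have [dense denseP] := dense_enumeration compactX.
(* A task [inl i] means following [gen i]; [inr b] means following the [w] selected by the bit of
   index [b]. *)
have [task taskP] := infinitely_often_enumeration (inl i0 : 'I_m + nat)%type.
have [l lP] := block_lengths M e0 T e0_gt0 good.
pose G k := M (l k) (e0 / 2 ^+ k.+1); pose s k := (l k + 2 * G k).-1.
have l_gt0 k : (0 < l k)%N by have [] := lP k.
have G_gt0 k : (0 < G k)%N.
  by have [[M0 _ _] _] := specM; apply: M0 => //; rewrite divr_gt0// exprn_gt0.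
have ls k : (l k <= s k)%N by rewrite /s; move: (G k) (G_gt0 k) (l k); clear; lia.
have sT k : (s k <= (1 + 2 * T) * l k)%N.
  by have [_ + _] := lP k; rewrite -/(G k) /s; move: (G k) (l k); clear; lia.
have sl k : (k.+1 * s k < l k.+1)%N by have [] := lP k.
have sl' k : (s k < l k.+1)%N by apply: leq_ltn_trans (sl k); rewrite leq_pmull.
have kl := block_lengths_ge s l l_gt0 ls sl.
pose y (a : nat -> bool) k := match task k with inl i => gen i | inr b => w (a b) end.
have [z zP] := choice (fun a => nested_shadowing f M compactX cont_f specM e0 l u
  dense (y a) e0_gt0 l_gt0 sl').
have yz a : shadows f e0 s l (y a) (z a) by have [] := zP a.
have far a a' : a <> a' -> forall N, exists2 k, (N <= k)%N & forall k',
    (s k <= k' < l k.+1)%N -> t / 2 <= mdist (iter k' f (z a)) (iter k' f (z a')).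
  move=> aa'; have [b ab] : exists b, a b <> a' b.
    apply: contrapT => H; apply: aa'; apply/funext => b; apply: contrapT => ?.
    by apply: H; exists b.
  apply: (shadowed_far f e0 s l (y a) (y a') (z a) (z a') (w (a b)) (w (a' b)) t
    (yz a) (yz a') _ t0) => [N|k].
    have [k Nk kb] := taskP (inr b) N; exists k => //.
    by rewrite /y kb.
  case: (a b) (a' b) ab => [] [] ab; [by case: ab| |exact: wt|by case: ab].
  by rewrite metric_sym.
(* Different bit sequences give orbits that are at least [t / 2] apart at some time. *)
have zinj : injective z.
  move=> a a' zaa'; apply: contrapT => aa'.
  have [k _ /(_ (s k))] := far a a' aa' 0%N.
  by rewrite leqnn sl' zaa' mdistxx => /(_ isT); rewrite leNgt divr_gt0.
exists (range z); split.
- exact: uncountable_range.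
- move=> _ _ [a _ <-] [a' _ <-] zaa'.
  have aa' : a <> a' by move=> aa'; apply: zaa'; rewrite aa'.
  apply: (DC1_pair_blocks f (z a) (z a') s l (t / 2)) => //.
  + by move=> k; exact: ltnW.
  + apply: (shadowed_close f e0 s l (y a) (y a') (z a) (z a') (gen i0)) => // N.
    by have [k Nk ki] := taskP (inl i0) N; exists k => //; rewrite /y ki.
  + by rewrite divr_gt0.
  + exact: far.
move=> _ [a _ <-]; have [uz pz _] := zP a; split; first split.
- move=> i _ j _; split.
    apply: (shadowed_generic_Vf f e0 s l compactX ls l_gt0 sl (mu i) (gen i) (z a) (y a)
      (genP i) (yz a)) => N.
    by have [k Nk ki] := taskP (inl i) N; exists k => //; rewrite /y ki.
  (* A common threshold beyond which every possible block target has averages of [g j] at least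
     [c1]. *)
  have [N1 N1P] := @finite_forall_nat m (fun i N => forall k, (N <= k)%N ->
      c0 * k%:R <= birkhoff_sum f (g j) k (gen i))
    (fun i a b ab H k bk => H k (leq_trans ab bk)) (fun i => gen_c0 i j).
  have [N2 N2P] := wc j false; have [N3 N3P] := wc j true.
  have [N NP] := birkhoff_sum_lower_bound f compactX e0 T s l l_gt0 ls sT sl (g j) c1
    (maxn N1 (maxn N2 N3)) (cg j) (g0 j) c1_gt0.
  apply: (not_Vf f compactX (z a) (nu j) (g j) c2 N (cg j)).
    have [_ _ _ nug] := gP j; apply: le_lt_trans nug _.
    by rewrite ltr_pdivrMr// ltr_pMr// ltr1n.
  apply: NP (yz a) _ => k k'; rewrite !geq_max => /and3P[k1 k2 k3].
  rewrite /y; case: (task k) => [i'|b].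
    by apply: le_trans (N1P i' k' k1); rewrite ler_wpM2r.
  by case: (a b); [exact: N3P|exact: N2P].
- apply: rU; rewrite ballEmdist /=; apply: le_lt_trans uz _.
  by rewrite ltr_pdivrMr// ltr_pMr// ltr1n.
- apply: dense_visits_Trans => x d N d0.
  have [K KP] := shadow_radius e0 _ (divr_gt0 d0 (ltr0n R 2)).
  have [k] := denseP x (d / 2) (maxn N K) (divr_gt0 d0 (ltr0n R 2)).
  rewrite geq_max => /andP[Nk Kk] px.
  (* The instant in the gap before block [k] at which the orbit visits [dense k]. *)
  exists (l k + G k).-1; first by move: (G k) (l k) Nk (G_gt0 k) (kl k); clear; lia.
  apply: le_lt_trans (metric_triangle _ (dense k) _) _.
  move: px (pz k) (KP k Kk); rewrite -/(G k) (metric_sym x).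
  by move: (iter _ f (z a)) (e0 / _) => v ek; clear; lra.
Qed.
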